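(* Let $q$ be a prime power, let $P = P(t) \in \mathbb{F}_q[t]$ be a monic irreducible polynomial, and let $H$ be a $P^{\infty}$-torsion $\mathbb{F}_q[t]$-module of finite length. Write $h := \dim_{\mathbb{F}_q}(H)$. For $d \in \mathbb{Z}_{\ge 0}$, define $b_n(d)$ ($n \in \mathbb{Z}_{\ge 0}$) by $$\sum_{n=0}^{\infty} b_n(d) u^n = \prod_{i=1}^{\infty} \frac{1 - (q^{-i}u)^d}{1 - q^{1-i}u} \in \mathbb{C}[[u]].$$ Then for every $n \in \mathbb{Z}_{\ge 0}$, $$\mathrm{Prob}_{A \in \mathrm{Mat}_n(\mathbb{F}_q)}(A[P^{\infty}] \simeq H) = \begin{cases} \dfrac{b_{n-h}(\deg(P))}{|\mathrm{Aut}_{\mathbb{F}_q[t]}(H)|} \displaystyle\prod_{i=1}^{n} (1 - q^{-i}) & \text{if } n \ge h, \\ 0 & \text{if } n < h. \end{cases}$$ Moreover, $$\lim_{n \to \infty} b_n(d) = \prod_{i=1}^{\infty} \frac{1 - q^{-id}}{1 - q^{-i}},$$ so that $$\lim_{n \to \infty} \mathrm{Prob}_{A \in \mathrm{Mat}_n(\mathbb{F}_q)}(A[P^{\infty}] \simeq H) = \frac{1}{|\mathrm{Aut}_{\mathbb{F}_q[t]}(H)|} \prod_{i=1}^{\infty} (1 - q^{-i \deg(P)}).$$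
   Context: $\mathrm{Mat}_n(\mathbb{F}_q)$ is the set of $n \times n$ matrices over $\mathbb{F}_q$, and $\mathrm{Prob}_{A \in \mathrm{Mat}_n(\mathbb{F}_q)}$ is probability with respect to the uniform distribution on this finite set. For an $\mathbb{F}_q[t]$-module $M$ and a polynomial $P$, $M[P^{\infty}] := \{x \in M : P^N x = 0 \text{ for } N \gg 0\}$ (the $P$-part of $M$), and $M$ is called $P^{\infty}$-torsion if $M = M[P^{\infty}]$. For $A \in \mathrm{Mat}_n(\mathbb{F}_q)$, $A[P^{\infty}]$ denotes $M[P^{\infty}]$ where $M = \mathbb{F}_q^n$ is viewed as an $\mathbb{F}_q[t]$-module via $t \cdot v := Av$; isomorphisms $\simeq$ are of $\mathbb{F}_q[t]$-modules. *)

(* Defs.v *)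
From HB Require Import structures.
From mathcomp Require Import all_boot all_order all_algebra.
From mathcomp Require Import finmap.
From mathcomp Require Import all_classical all_reals all_analysis.
Set Implicit Arguments.
Unset Strict Implicit.
Unset Printing Implicit Defensive.
Import Order.TTheory GRing.Theory Num.Theory numFieldNormedType.Exports.
Local Open Scope ring_scope.
Local Open Scope classical_set_scope.

Definition lmod_iso (A : pzRingType) (U V : lmodType A) : Prop :=
  exists f : {linear U -> V}, bijective f.

(* Plain functions rather than {linear M -> M}, which has no choiceType       *)
(* structure; fset_set is fset0 on infinite sets.                             *)
Definition card_aut (A : pzRingType) (M : lmodType A) : nat :=
  #|` fset_set [set f : M -> M | linear f /\ bijective f] |%fset.

(* Existence of a composition series: the last clause says that               *)
(* c i.+1 / c i is simple.                                                    *)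
Definition finite_length (A : pzRingType) (M : lmodType A) : Prop :=
  exists (n : nat) (c : nat -> {pred M}),
    [/\ forall i, (i <= n)%N -> GRing.submod_closed (c i),
        c 0 =i pred1 0,
        c n =i predT
      & forall i, (i < n)%N ->
        [/\ {subset c i <= c i.+1},
            ~ (c i =i c i.+1)
          & forall S : {pred M}, GRing.submod_closed S ->
              {subset c i <= S} -> {subset S <= c i.+1} ->
              S =i c i \/ S =i c i.+1]].

Definition Ppart (A : comPzRingType) (P : A) (M : lmodType A) : {pred M} :=
  fun x => `[< exists N0 : nat, forall N, (N0 <= N)%N -> P ^+ N *: x = 0 >].

Lemma Ppart_submod (A : comPzRingType) (P : A) (M : lmodType A) :
  GRing.subsemimod_closed (Ppart P (M := M)).
Proof.
split; first split.
- by apply/asboolP; exists 0%N => N _; rewrite scaler0.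
- move=> x y /asboolP[m mP] /asboolP[n nP]; apply/asboolP.
  exists (maxn m n) => N; rewrite geq_max => /andP[mN nN].
  by rewrite scalerDr mP// nP// addr0.
- move=> a x /asboolP[m mP]; apply/asboolP; exists m => N mN.
  by rewrite scalerA mulrC -scalerA mP// scaler0.
Qed.

HB.instance Definition _ (A : comPzRingType) (P : A) (M : lmodType A) :=
  GRing.isSubmodClosed.Build A M (Ppart P (M := M)) (Ppart_submod P M).

Definition Ptorsion (A : comPzRingType) (P : A) (M : lmodType A) : Prop :=
  Ppart P (M := M) =i predT.

(* M[P^oo] as a module *)
Record Pmod (A : comPzRingType) (P : A) (M : lmodType A) :=
  MkPmod { Pmod_val : M; _ : Pmod_val \in Ppart P (M := M) }.

HB.instance Definition _ (A : comPzRingType) (P : A) (M : lmodType A) :=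
  [isSub for @Pmod_val A P M].
HB.instance Definition _ (A : comPzRingType) (P : A) (M : lmodType A) :=
  [Choice of Pmod P M by <:].
HB.instance Definition _ (A : comPzRingType) (P : A) (M : lmodType A) :=
  [SubChoice_isSubLmodule of Pmod P M by <:].

(* F^n with t acting as A. *)
Definition mxmod (F : fieldType) (n : nat) (A : 'M[F]_n) : Type := 'cV[F]_n.

Section MxMod.
Variables (F : fieldType) (n : nat) (A : 'M[F]_n).

HB.instance Definition _ := GRing.Zmodule.on (mxmod A).

(* horner_mx A p is only available for sizes n of the form m.+1 *)
Definition mxmod_scale (p : {poly F}) (v : mxmod A) : mxmod A :=
  (\sum_(i < size p) p`_i *: A ^+ i) *m v.

Let ev (p : {poly F}) : 'M[F]_n := \sum_(i < size p) p`_i *: A ^+ i.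

Let evE m (p : {poly F}) :
  (size p <= m)%N -> ev p = \sum_(i < m) p`_i *: A ^+ i.
Proof.
move=> pm; rewrite /ev -!(big_mkord xpredT (fun i => p`_i *: A ^+ i)).
rewrite [RHS](big_cat_nat (n := size p))//= [X in _ = _ + X]big_nat_cond.
rewrite [X in _ = _ + X]big1 ?addr0// => i /andP[/andP[pi _] _].
by rewrite nth_default// scale0r.
Qed.

Let evD : {morph ev : p q / p + q}.
Proof.
move=> p q; have pq := size_polyD p q.
rewrite (evE pq) (evE (leq_maxl (size p) (size q))).
rewrite (evE (leq_maxr (size p) (size q))) -big_split/=.
by apply: eq_bigr => i _; rewrite coefD scalerDl.
Qed.

Let ev0 : ev 0 = 0.
Proof. by rewrite /ev size_poly0 big_ord0. Qed.

Let evZ c (p : {poly F}) : ev (c *: p) = c *: ev p.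
Proof.
rewrite (evE (size_scale_leq c p)) scaler_sumr.
by apply: eq_bigr => i _; rewrite coefZ scalerA.
Qed.

Let evXn k : ev 'X^k = A ^+ k.
Proof.
rewrite /ev size_polyXn big_ord_recr/= coefXn eqxx scale1r big1 ?add0r// => i _.
by rewrite coefXn ltn_eqF// scale0r.
Qed.

Let evM : {morph ev : p q / p * q >-> p *m q}.
Proof.
have ev_sum m (G : 'I_m -> {poly F}) : ev (\sum_i G i) = \sum_i ev (G i).
  by apply: (big_morph ev evD ev0).
move=> p q; rewrite -[p in LHS]coefK -[q in LHS]coefK !poly_def.
rewrite mulr_suml ev_sum [in RHS]/ev mulmx_suml; apply: eq_bigr => i _.
rewrite mulr_sumr ev_sum mulmx_sumr; apply: eq_bigr => j _.
rewrite -scalerAl -scalerAr !evZ -exprD evXn exprD.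
by rewrite -scalemxAl -scalemxAr.
Qed.

Let scaleE p v : mxmod_scale p v = ev p *m v.
Proof. by []. Qed.

Lemma mxmod_scaleA (a b : {poly F}) (v : mxmod A) :
  mxmod_scale a (mxmod_scale b v) = mxmod_scale (a * b) v.
Proof. by rewrite !scaleE evM mulmxA. Qed.

Lemma mxmod_scale1 : left_id 1 mxmod_scale.
Proof. by move=> v; rewrite scaleE -(expr0 'X) evXn mul1mx. Qed.

Lemma mxmod_scaleDr : right_distributive mxmod_scale +%R.
Proof. by move=> p u v; rewrite !scaleE mulmxDr. Qed.

Lemma mxmod_scaleDl (v : mxmod A) :
  {morph mxmod_scale^~ v : a b / a + b}.
Proof. by move=> p q; rewrite !scaleE evD mulmxDl. Qed.

HB.instance Definition _ := GRing.Zmodule_isLmodule.Build {poly F} (mxmod A)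
  mxmod_scaleA mxmod_scale1 mxmod_scaleDr mxmod_scaleDl.

Lemma mxmod_scaleX (v : mxmod A) : 'X *: v = A *m v.
Proof. by rewrite -[LHS]/(ev 'X *m v) -['X]expr1 evXn. Qed.

Lemma mxmod_scaleC (c : F) (v : mxmod A) : c%:P *: v = c *: (v : 'cV[F]_n).
Proof.
rewrite -[LHS]/(ev c%:P *m v) -[c%:P]mulr1 mul_polyC.
by rewrite evZ -(expr0 'X) evXn -scalemxAl mul1mx.
Qed.

End MxMod.

(* An F[t]-module viewed as an F-vector space. *)
Definition resF (F : fieldType) (M : lmodType {poly F}) : Type := M.

Section ResF.
Variables (F : fieldType) (M : lmodType {poly F}).

HB.instance Definition _ := GRing.Zmodule.on (resF M).

Definition resF_scale (c : F) (x : resF M) : resF M := c%:P *: (x : M).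

Lemma resF_scaleA (a b : F) (x : resF M) :
  resF_scale a (resF_scale b x) = resF_scale (a * b) x.
Proof. by rewrite /resF_scale scalerA polyCM. Qed.

Lemma resF_scale1 : left_id 1 resF_scale.
Proof. by move=> x; rewrite /resF_scale scale1r. Qed.

Lemma resF_scaleDr : right_distributive resF_scale +%R.
Proof. by move=> c x y; rewrite /resF_scale scalerDr. Qed.

Lemma resF_scaleDl (x : resF M) : {morph resF_scale^~ x : a b / a + b}.
Proof. by move=> a b; rewrite /resF_scale polyCD scalerDl. Qed.

HB.instance Definition _ := GRing.Zmodule_isLmodule.Build F (resF M)
  resF_scaleA resF_scale1 resF_scaleDr resF_scaleDl.

End ResF.

(* As in Vector.axiom: the h with M isomorphic to F^h (and the junk value 0   *)
(* when M is infinite-dimensional).                                           *)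
Definition dimF (F : fieldType) (M : lmodType {poly F}) : nat :=
  xget 0%N [set h : nat | lmod_iso (resF M) 'rV[F]_h].

Definition unif_prob (R : realType) (T : finType) (E : T -> Prop) : R :=
  #|[set x : T | `[< E x >]]%SET|%:R / #|T|%:R.

Section PowerSeries.
Variable K : numFieldType.

(* K[[u]]; the n-th term is the coefficient of u^n *)
Definition fps : Type := nat -> K.

Definition fps_poly (p : {poly K}) : fps := fun n => p`_n.

Definition fps_one : fps := fps_poly 1.

Definition fps_mul (a b : fps) : fps :=
  fun n => \sum_(k < n.+1) a k * b (n - k)%N.

(* The first n coefficients of 1 / a, by                                      *)
(* b_m = a_0^-1 * ((m == 0) - \sum_(k < m) b_k a_(m - k)); see fps_mulV.      *)
Fixpoint fps_inv_seq (a : fps) (n : nat) : seq K :=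
  if n is m.+1 then
    let b := fps_inv_seq a m in
    rcons b ((a 0%N)^-1 *
             ((m == 0%N)%:R - \sum_(k < m) b`_k * a (m - k)%N))
  else [::].

Definition fps_inv (a : fps) : fps := fun n => (fps_inv_seq a n.+1)`_n.

Lemma size_fps_inv_seq a n : size (fps_inv_seq a n) = n.
Proof. by elim: n => //= n ih; rewrite size_rcons ih. Qed.

Lemma nth_fps_inv_seq a n k : (k < n)%N -> (fps_inv_seq a n)`_k = fps_inv a k.
Proof.
elim: n => // n ih; rewrite ltnS leq_eqVlt => /predU1P[->//|kn] /=.
by rewrite nth_rcons size_fps_inv_seq kn ih.
Qed.

Lemma fps_mulV (a : fps) : a 0%N != 0 -> fps_mul (fps_inv a) a = fps_one.
Proof.
move=> a0; apply/funext => n; rewrite /fps_mul big_ord_recr/= subnn.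
rewrite [fps_inv a n]/fps_inv/= nth_rcons size_fps_inv_seq ltnn eqxx.
rewrite mulrAC mulVf// mul1r /fps_one /fps_poly coef1.
rewrite [X in X + _](eq_bigr (fun k : 'I_n =>
  (fps_inv_seq a n)`_k * a (n - k)%N)) ?subrKC//.
by move=> i _; rewrite nth_fps_inv_seq.
Qed.

Definition fps_div (a b : fps) : fps := fps_mul a (fps_inv b).

Definition bfactor (q d i : nat) : fps :=
  fps_div (fps_poly (1 - (q%:R ^- i *: 'X) ^+ d))
          (fps_poly (1 - q%:R ^ (1 - i%:Z) *: 'X)).

(* The coefficient of u^n in \prod_(i >= 1) bfactor q d i. The partial        *)
(* products do not stabilise u-adically: the infinite product is the          *)
(* coefficientwise limit for the topology of K.                               *)
Definition bcoef (q d n : nat) : K :=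
  lim ((\big[fps_mul/fps_one]_(1 <= i < N.+1) bfactor q d i) n @[N --> \oo]).

Definition infprod (f : nat -> K) : K :=
  lim (\prod_(1 <= i < N.+1) f i @[N --> \oo]).

End PowerSeries.

(* Main.v *)
From HB Require Import structures.
Require Import Defs.
From mathcomp Require Import all_boot all_order all_algebra.
From mathcomp Require Import finmap.
From mathcomp Require Import all_classical all_reals all_analysis.
From mathcomp Require Import complex.
From mathcomp Require Import zify ring lra.
Set Implicit Arguments.
Unset Strict Implicit.
Unset Printing Implicit Defensive.
Import Order.TTheory GRing.Theory Num.Theory numFieldNormedType.Exports.
Local Open Scope ring_scope.

(* Let c_m be the number of B in Mat_m(F) with P(B) invertible and             *)
(* gamma_m = c_m / |GL_m(F)|. By Fitting's lemma A[P^oo] ~ H exactly when A is  *)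
(* conjugate to diag(A_H, B) with A_H a matrix of t on H and P(B) invertible;  *)
(* the centraliser consists of block diagonal matrices, so the number of such  *)
(* A is |GL_n| gamma_(n-h) / |Aut H|. To compute gamma, count the pairs (A, v) *)
(* with P(A) invertible according to the dimension k of the submodule          *)
(* generated by v: in a suitable basis A is block triangular with a companion  *)
(* block, whence q^m gamma_m = \sum_k phi_k gamma_(m-k), where phi_k counts    *)
(* the monic polynomials of degree k prime to P. As                            *)
(* phi_k = q^k - [k >= d] q^(k-d), this becomes                                *)
(*   (q^m - 1) gamma_m = q^m gamma_(m-1) - gamma_(m-d),                        *)
(* which is also the recursion of b_m(d), read off from                        *)
(* (1 - q u) B(q u) = (1 - u^d) B(u). Finally, with G(u) = (1 - u) B(u), the   *)
(* limit of b_n is G(1), and the functional equation                           *)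
(* G(u) = (1 - (u/q)^d) / (1 - u/q) G(u/q), iterated, gives                    *)
(* G(1) = \prod_(i <= N) (1 - q^(-id)) / (1 - q^-i) G(q^-N) with G(q^-N) -> 1. *)

(** * Polynomials in a matrix and orbit counting *)

(** Both counts are instances of [orbit_count]. For the first, [card_diag_orbit] together with
    [Pmod_block_diag] and [Pmod_iso_block_diag] reduces the probability to gamma_(n-h)
    ([card_Pmod_iso]). For the second, [card_cyclic_pairs_block] yields the recursion
    [punit_ratio_rec]. Since q^m - 1 is nonzero for m > 0, a sequence with this recursion is
    determined by its value at 0, so gamma = b by [bcoef_unique], without any closed form for gamma.
    On the side of b one needs that the coefficientwise limit exists ([cvg_bpart]) and satisfies the
    recursion ([bcoef_rec]). The limits are then derived over the reals from the recursion alone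
    ([cvg_rec], [cvg_prod_ratio]) and carried to [R[i]] by [bcoef_real], again through
    uniqueness. *)

Section PolyMx.
Variable F : fieldType.

(** This is the very sum inside [mxmod_scale], so that the action of [p] is multiplication by
    [pmx A p] by conversion, and the module axioms give the multiplicativity and additivity of
    [pmx]. *)
Definition pmx n (A : 'M[F]_n) (p : {poly F}) : 'M[F]_n :=
  \sum_(i < size p) p`_i *: A ^+ i.

Lemma mxmod_scaleE n (A : 'M[F]_n) p (v : mxmod A) : p *: v = pmx A p *m v.
Proof. by []. Qed.

Lemma eq_mulmx_col m n (A B : 'M[F]_(m, n)) :
  (forall v : 'cV_n, A *m v = B *m v) -> A = B.
Proof.
move=> AB; apply/matrixP => i j.
by have /matrixP/(_ i 0) := AB (delta_mx j 0); rewrite -!colE !mxE.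
Qed.

Lemma invmxM n (A B : 'M[F]_n) : A \in unitmx -> B \in unitmx ->
  invmx (A *m B) = invmx B *m invmx A.
Proof.
move=> Au Bu; have ABu : A *m B \in unitmx by rewrite unitmx_mul Au.
by apply: (can_inj (mulKmx ABu)); rewrite mulmxV// -mulmxA mulKVmx// mulmxV.
Qed.

Lemma pmxM n (A : 'M[F]_n) p q : pmx A (p * q) = pmx A p *m pmx A q.
Proof.
apply: eq_mulmx_col => v.
rewrite -mulmxA -[RHS]/(p *: (q *: (v : mxmod A))).
by rewrite scalerA.
Qed.

Lemma pmx1 n (A : 'M[F]_n) : pmx A 1 = 1%:M.
Proof.
apply: eq_mulmx_col => v.
by rewrite -[LHS]/(1 *: (v : mxmod A)) scale1r mul1mx.
Qed.

Lemma intertwine_exp m n (A : 'M[F]_m) (B : 'M[F]_n) (X : 'M[F]_(m, n)) i :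
  A *m X = X *m B -> A ^+ i *m X = X *m B ^+ i.
Proof.
move=> AX; elim: i => [|i ih]; first by rewrite !expr0 mul1mx mulmx1.
by rewrite !exprS -!mulmxE -mulmxA ih mulmxA AX -mulmxA.
Qed.

(** The main tool for block computations: [X] will be an inclusion, a projection, a change of basis
    or an off-diagonal block. *)
Lemma intertwine_pmx m n (A : 'M[F]_m) (B : 'M[F]_n) (X : 'M[F]_(m, n)) p :
  A *m X = X *m B -> pmx A p *m X = X *m pmx B p.
Proof.
move=> AX; rewrite mulmx_suml mulmx_sumr; apply: eq_bigr => i _.
by rewrite -scalemxAl -scalemxAr (intertwine_exp _ AX).
Qed.

Lemma pmx_exp_unit n (A : 'M[F]_n) p k :
  pmx A p \in unitmx -> pmx A (p ^+ k) \in unitmx.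
Proof.
move=> pu; elim: k => [|k ih]; first by rewrite expr0 pmx1 unitmx1.
by rewrite exprS pmxM unitmx_mul pu.
Qed.

Lemma pmx_conj_unit n (A g : 'M[F]_n) p : g \in unitmx ->
  (pmx (invmx g *m A *m g) p \in unitmx) = (pmx A p \in unitmx).
Proof.
move=> gu; have : pmx A p *m g = g *m pmx (invmx g *m A *m g) p.
  by apply: intertwine_pmx; rewrite !mulmxA mulmxV// mul1mx.
by move/(congr1 (fun M => M \in unitmx)); rewrite !unitmx_mul gu andbT => ->.
Qed.

(** Intertwining with the inclusion of the first block and the projection to the second shows that
    [pmx T p] is again block triangular, with diagonal blocks [pmx A p] and [pmx B p]; the
    determinant then decides. *)
Lemma pmx_ublock_unit m n (A : 'M[F]_m) (D : 'M[F]_(m, n)) (B : 'M[F]_n) p :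
  (pmx (block_mx A D 0 B) p \in unitmx) =
  (pmx A p \in unitmx) && (pmx B p \in unitmx).
Proof.
set T := block_mx A D 0 B.
have TX : T *m col_mx 1%:M 0 = col_mx 1%:M 0 *m A.
  by rewrite mul_block_col mul_col_mx !(mul0mx, mulmx0, mulmx1, mul1mx, addr0).
have YT : B *m row_mx 0 1%:M = row_mx 0 1%:M *m T.
  by rewrite mul_row_block mul_mx_row !(mul0mx, mulmx0, mulmx1, mul1mx, add0r).
have := intertwine_pmx p TX; have := intertwine_pmx p YT.
rewrite -[pmx T p]submxK; set U := ulsubmx _; set V := ursubmx _.
set W := dlsubmx _; set Z := drsubmx _.
rewrite mul_row_block mul_mx_row !(mul0mx, mulmx0, mulmx1, mul1mx, add0r).
case/eq_row_mx => <- <-.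
rewrite mul_block_col mul_col_mx !(mul0mx, mulmx0, mulmx1, mul1mx, addr0).
by case/eq_col_mx => -> _; rewrite !unitmxE det_ublock unitrM.
Qed.

End PolyMx.

Section Count.
Variable F : finFieldType.

Definition glset n : {set 'M[F]_n} := [set g | g \in unitmx].

Definition punitset (P : {poly F}) n : {set 'M[F]_n} :=
  [set A | pmx A P \in unitmx].

(** Double count of the set [E] of pairs (g, A) with g invertible and g^-1 A g in [D]. It is in
    bijection with GL x D, and the fibres of (g, A) -> (A, tag g) are cosets gK, by the hypothesis
    on [K]. The tag records what is moved along with the matrix: nothing for block diagonal forms, a
    vector for cyclic pairs. *)
Lemma orbit_count n (T : finType) (tag : 'M[F]_n -> T) (D K : {set 'M[F]_n}) :
  K \subset glset n ->
  (forall g A k, g \in unitmx -> k \in unitmx -> A \in D ->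
     (invmx k *m A *m k \in D) && (tag (g *m k) == tag g) = (k \in K)) ->
  (#|[set x : 'M[F]_n * T | [exists g, [&& g \in unitmx,
       invmx g *m x.1 *m g \in D & tag g == x.2]]]| * #|K| = #|glset n| * #|D|)%N.
Proof.
move=> /fintype.subsetP Ku DK.
pose E := [set y : 'M[F]_n * 'M[F]_n |
  (y.1 \in unitmx) && (invmx y.1 *m y.2 *m y.1 \in D)].
have EgD : #|E| = (#|glset n| * #|D|)%N.
  rewrite -cardsX -[RHS](card_in_imset (f := fun y => (y.1, y.1 *m y.2 *m invmx y.1))).
    apply: eq_card => -[g A]; rewrite !inE/=; apply/andP/imsetP.
      move=> [gu gA]; exists (g, invmx g *m A *m g); rewrite ?inE/= ?gu//.
      by rewrite !mulmxA mulmxV// mul1mx mulmxK.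
    move=> [[g' A']]; rewrite !inE/= => /andP[gu AD] [-> ->]; split=> //.
    by rewrite !mulmxA mulVmx// mul1mx mulmxKV.
  move=> [g A] [g' A']; rewrite !inE/= => /andP[gu AD] /andP[_ AD'] [<-] /eqP.
  by rewrite (can_eq (mulmxKV gu)) (can_eq (mulKmx gu)) => /eqP->.
rewrite -EgD -[#|E|]sum1_card.
rewrite (partition_big (fun y => (y.2, tag y.1)) [in [set x : 'M[F]_n * T | [exists g,
    [&& g \in unitmx, invmx g *m x.1 *m g \in D & tag g == x.2]]]])/=; last first.
  move=> [g A]; rewrite !inE/= => /andP[gu gA]; apply/existsP; exists g.
  by rewrite gu gA eqxx.
rewrite -sum_nat_const; apply: eq_bigr => -[A t]; rewrite inE/=.
move=> /existsP[g /and3P[gu gA /eqP tg]].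
rewrite sum1_card; apply/esym.
transitivity #|[set (g *m k, A) | k in K]|; last first.
  by rewrite card_imset// => k k' [] /(can_inj (mulKmx gu)).
apply: eq_card => -[g' A']; rewrite unfold_in /= inE/= xpair_eqE.
apply/idP/imsetP; last first.
  move=> [k kK [-> ->]]; have ku : k \in unitmx by have := Ku _ kK; rewrite inE.
  have := DK _ _ _ gu ku gA; rewrite kK => /andP[kD /eqP tk].
  rewrite unitmx_mul gu ku eqxx -tg tk eqxx !andbT/=.
  by rewrite invmxM// !mulmxA in kD *.
move=> /andP[/andP[g'u g'A] /andP[/eqP AA' /eqP tg']]; rewrite AA' in g'A *.
have ku : invmx g *m g' \in unitmx by rewrite unitmx_mul unitmx_inv gu.
exists (invmx g *m g'); last by rewrite mulmxA mulmxV// mul1mx.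
rewrite -(DK _ _ _ gu ku gA) (mulKVmx gu) tg tg' eqxx andbT.
by rewrite invmxM ?unitmx_inv// invmxK !mulmxA mulmxK// mulmxK.
Qed.

End Count.

(** * The primary part of a matrix *)

Section BlockDiag.
Variables (F : finFieldType) (P : {poly F}) (h r N : nat) (M : 'M[F]_h).
Hypothesis PM : pmx M (P ^+ N) = 0.

(** The automorphism group of [mxmod M]; see [card_aut_mxmod]. *)
Definition cent_set : {set 'M[F]_h} :=
  [set k | (k \in unitmx) && (M *m k == k *m M)].

Definition diag_set : {set 'M[F]_(h + r)} :=
  [set block_mx M 0 0 B | B in punitset P r].

Let K : {set 'M[F]_(h + r)} :=
  [set block_mx k.1 0 0 k.2 | k in finset.setX cent_set (glset F r)].

Lemma block_diag_unit (a : 'M[F]_h) (b : 'M[F]_r) :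
  (block_mx a 0 0 b \in unitmx) = (a \in unitmx) && (b \in unitmx).
Proof. by rewrite !unitmxE det_ublock unitrM. Qed.

(** A matrix conjugating diag(M, B0) to diag(M, B) is itself block diagonal: its off-diagonal blocks
    intertwine [M], which P^N kills, with a matrix on which P^N is invertible, so they vanish. *)
Lemma card_diag_orbit :
  (#|[set A : 'M[F]_(h + r) |
      [exists g, (g \in unitmx) && (invmx g *m A *m g \in diag_set)]]| *
   (#|cent_set| * #|glset F r|) = #|glset F (h + r)| * #|punitset P r|)%N.
Proof.
have <- : #|K| = (#|cent_set| * #|glset F r|)%N.
  rewrite -cardsX card_in_imset// => -[a b] [a' b'] _ _ /= /eq_block_mx.
  by case=> -> _ _ ->.
have <- : #|diag_set| = #|punitset P r|.
  by rewrite card_imset// => b b' /eq_block_mx[].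
rewrite -(@orbit_count F (h + r) unit (fun=> tt) diag_set K).
- congr (_ * _)%N; rewrite -(card_imset (f := fst)); last first.
    by move=> [A []] [A' []] /= ->.
  apply: eq_card => A; rewrite inE; apply/idP/imsetP.
    move=> AD; exists (A, tt) => //; rewrite inE.
    by move: AD => /existsP[g gA]; apply/existsP; exists g; rewrite andbT.
  move=> [[A' []]]; rewrite inE => /existsP[g /= gA] ->.
  by apply/existsP; exists g; rewrite andbT in gA.
- apply/fintype.subsetP => _ /imsetP[[a b] ab ->]; rewrite !inE block_diag_unit/=.
  by move: ab; rewrite !inE/= => /andP[/andP[-> _] ->].
move=> _ _ k _ ku /imsetP[B0 B0u ->]; rewrite eqxx andbT.
apply/imsetP/imsetP => [[B Bu kE]|[[a b]]].
  have {}kE : block_mx M 0 0 B0 *m k = k *m block_mx M 0 0 B.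
    by rewrite -kE !mulmxA mulmxV// mul1mx.
  have [a [b [c [e kd]]]] : exists a b c e, k = block_mx a b c e.
    exists (ulsubmx k), (ursubmx k), (dlsubmx k), (drsubmx k).
    by rewrite submxK.
  rewrite !inE in B0u Bu.
  move: kE; rewrite kd !mulmx_block !(mul0mx, mulmx0, add0r, addr0).
  move=> /eq_block_mx[Ma Mb Bc _].
  have b0 : b = 0.
    have /esym := intertwine_pmx (P ^+ N) Mb; rewrite PM mul0mx.
    by move=> /(congr1 (mulmxr (invmx (pmx B (P ^+ N)))))/=;
      rewrite mulmxK ?pmx_exp_unit// mul0mx.
  have c0 : c = 0.
    have := intertwine_pmx (P ^+ N) Bc; rewrite PM mulmx0.
    by move=> /(congr1 (mulmx (invmx (pmx B0 (P ^+ N)))));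
      rewrite mulKmx ?pmx_exp_unit// mulmx0.
  rewrite b0 c0 in kd; rewrite kd block_diag_unit in ku.
  have /andP[au eu] := ku.
  exists (a, e); last by rewrite b0 c0.
  by apply/finset.setXP; rewrite /= !inE au eu; split=> //=; exact/eqP.
rewrite !inE/= => /andP[/andP[au /eqP Ma] bu] ->.
exists (invmx b *m B0 *m b); first by rewrite inE in B0u; rewrite inE pmx_conj_unit.
rewrite invmx_block_diag ?block_diag_unit ?au ?bu//.
rewrite !mulmx_block !(mul0mx, mulmx0, add0r, addr0).
by rewrite -mulmxA Ma mulKmx.
Qed.

End BlockDiag.

Section Fitting.
Variable F : fieldType.

(** The constants of [{poly F}] give F-linearity, hence a matrix; the action of ['X] gives the
    intertwining relation. *)
Lemma linear_mxmod m n (M : 'M[F]_m) (A : 'M[F]_n)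
    (f : {linear mxmod M -> mxmod A}) :
  exists2 X : 'M[F]_(n, m), A *m X = X *m M & forall v : 'cV_m, f v = X *m v.
Proof.
pose X : 'M[F]_(n, m) := \matrix_(i, j) (f (delta_mx j 0) : 'cV_n) i 0.
have fZ c (u : 'cV_m) : f (c *: u) = c *: (f u : 'cV_n).
  by rewrite -(mxmod_scaleC (A := M)) linearZ/= mxmod_scaleC.
have fsum (G : 'I_m -> 'cV_m) : f (\sum_i G i) = \sum_i (f (G i) : 'cV_n).
  exact: (raddf_sum f).
have fX (v : 'cV_m) : f v = X *m v.
  rewrite [v in LHS]matrix_sum_delta fsum; apply/colP => i.
  rewrite summxE [RHS]mxE; apply: eq_bigr => j _.
  by rewrite big_ord1 fZ !mxE mulrC.
exists X => //; apply: eq_mulmx_col => v.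
by rewrite -!mulmxA -!fX -!mxmod_scaleX linearZ.
Qed.

Lemma Ppart_exp (P : {poly F}) (V : lmodType {poly F}) (v : V) k :
  P ^+ k *: v = 0 -> v \in Ppart P (M := V).
Proof.
move=> Pv; apply/asboolP; exists k => N kN.
by rewrite -(subnK kN) exprD -scalerA Pv scaler0.
Qed.

Lemma lmod_iso_sym (R : pzRingType) (U V : lmodType R) :
  lmod_iso U V -> lmod_iso V U.
Proof.
move=> [f [g fK gK]].
have lg : linear g.
  by move=> a x y; apply: (can_inj fK); rewrite linearP !gK.
pose G : {linear V -> U} := HB.pack g (GRing.isLinear.Build _ _ _ _ g lg).
by exists G; exists f.
Qed.

Lemma lmod_iso_trans (R : pzRingType) (U V W : lmodType R) :
  lmod_iso U V -> lmod_iso V W -> lmod_iso U W.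
Proof. by move=> [f bf] [g bg]; exists (g \o f); apply: bij_comp. Qed.

Variables (P : {poly F}) (h r N : nat) (M : 'M[F]_h) (A : 'M[F]_(h + r)).
Hypothesis PM : pmx M (P ^+ N) = 0.

(** The second component of a vector killed by a power of P is killed by an invertible matrix, hence
    zero; so the P-part is exactly the first block, with [U] and [X] as inverse isomorphisms. *)
Lemma Pmod_block_diag (g : 'M[F]_(h + r)) (B : 'M[F]_r) :
  g \in unitmx -> pmx B P \in unitmx ->
  invmx g *m A *m g = block_mx M 0 0 B -> lmod_iso (Pmod P (mxmod A)) (mxmod M).
Proof.
move=> gu Bu gA.
have gA' : invmx g *m A = block_mx M 0 0 B *m invmx g by rewrite -gA mulmxK.
pose U := row_mx 1%:M 0 *m invmx g : 'M[F]_(h, h + r).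
pose L := row_mx 0 1%:M *m invmx g : 'M[F]_(r, h + r).
pose X := g *m col_mx 1%:M 0 : 'M[F]_(h + r, h).
have UA : M *m U = U *m A.
  rewrite -mulmxA gA' !mulmxA; congr (_ *m _).
  by rewrite mul_mx_row mul_row_block !(mul0mx, mulmx0, mul1mx, mulmx1, addr0).
have LA : B *m L = L *m A.
  rewrite -mulmxA gA' !mulmxA; congr (_ *m _).
  by rewrite mul_mx_row mul_row_block !(mul0mx, mulmx0, mul1mx, mulmx1, add0r).
have AX : A *m X = X *m M.
  have -> : A *m X = g *m block_mx M 0 0 B *m col_mx 1%:M 0.
    by rewrite -gA !mulmxA mulmxV// mul1mx.
  rewrite -!mulmxA; congr (_ *m _).
  by rewrite mul_block_col mul_col_mx !(mul0mx, mulmx0, mul1mx, mulmx1, addr0).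
have UX : U *m X = 1%:M.
  by rewrite -mulmxA mulKmx// mul_row_col mulmx1 mul0mx addr0.
pose f (v : Pmod P (mxmod A)) : mxmod M := U *m (val v : 'cV_(h + r)).
have lf : linear f.
  move=> a x y; rewrite /f linearP/= !mxmod_scaleE mulmxDr mulmxA.
  by rewrite -(intertwine_pmx a UA) -mulmxA.
pose ff : {linear Pmod P (mxmod A) -> mxmod M} :=
  HB.pack f (GRing.isLinear.Build _ _ _ _ f lf).
have XP (w : 'cV_h) : (X *m w : mxmod A) \in Ppart P (M := mxmod A).
  apply: (@Ppart_exp _ _ _ N); rewrite mxmod_scaleE mulmxA.
  by rewrite (intertwine_pmx _ AX) PM mulmx0 mul0mx.
exists ff, (fun w => MkPmod (XP w)) => [v|w] /=; last first.
  by rewrite /f/= mulmxA UX mul1mx.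
apply: val_inj; rewrite /= /f.
have : val v \in Ppart P (M := mxmod A) by exact: valP.
move=> /asboolP[k /(_ _ (leqnn k)) vk].
have Lv : L *m (val v : 'cV_(h + r)) = 0.
  have vk' : pmx A (P ^+ k) *m (val v : 'cV_(h + r)) = 0 by exact: vk.
  have : pmx B (P ^+ k) *m (L *m (val v : 'cV_(h + r))) = 0.
    by rewrite mulmxA (intertwine_pmx _ LA) -mulmxA vk' mulmx0.
  move=> /(congr1 (mulmx (invmx (pmx B (P ^+ k))))).
  by rewrite mulKmx ?pmx_exp_unit// mulmx0.
have XU : X *m U = 1%:M - g *m col_mx 0 1%:M *m L.
  apply/eqP; rewrite eq_sym subr_eq; apply/eqP.
  rewrite -(mulmxV gu) /X /U /L !mulmxA -mulmxDl; congr (_ *m _).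
  rewrite -!mulmxA -mulmxDr -[LHS]mulmx1; congr (_ *m _).
  rewrite !mul_col_row !(mul0mx, mulmx0, mul1mx, mulmx1).
  by rewrite add_block_mx !(addr0, add0r) -scalar_mx_block.
by rewrite mulmxA XU mulmxBl mul1mx -[_ *m L *m _]mulmxA [L *m _]Lv mulmx0 subr0.
Qed.

(** Fitting decomposition for Q = P(A)^N: the P-part is ker Q, the complement is im Q, and both are
    stable under [A]. The columns of [X] and [Y] are bases of these two subspaces. *)
Lemma Pmod_iso_block_diag : lmod_iso (Pmod P (mxmod A)) (mxmod M) ->
  exists (g : 'M[F]_(h + r)) (B : 'M[F]_r), [/\ g \in unitmx, pmx B P \in unitmx
    & invmx g *m A *m g = block_mx M 0 0 B].
Proof.
move=> /lmod_iso_sym[f [f' fK f'K]].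
have [X AX fX] : exists2 X : 'M[F]_(h + r, h), A *m X = X *m M &
    forall v : 'cV_h, val (f v) = X *m v.
  have lvf : linear (fun v => val (f v)) by move=> a x y /=; rewrite !linearP.
  exact: (linear_mxmod (HB.pack (fun v => val (f v))
    (GRing.isLinear.Build _ (mxmod M) (mxmod A) _ _ lvf)
      : {linear mxmod M -> mxmod A})).
have imX (v : 'cV_(h + r)) : (v : mxmod A) \in Ppart P (M := mxmod A) ->
    exists w, v = X *m w.
  by move=> vP; exists (f' (MkPmod vP)); rewrite -fX f'K.
have injX (w : 'cV_h) : X *m w = 0 -> w = 0.
  rewrite -fX => fw0; apply: (can_inj fK); rewrite linear0.
  by apply: val_inj; rewrite fw0.
pose Q := pmx A (P ^+ N).
have QX : Q *m X = 0 by rewrite (intertwine_pmx _ AX) PM mulmx0.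
have kerQ (v : 'cV_(h + r)) : Q *m v = 0 -> exists w, v = X *m w.
  by move=> Qv; apply: imX; apply: (@Ppart_exp _ _ _ N).
(* Equivalently ker Q and im Q meet trivially: such a [v] lies in the P-part, which Q already
   kills. *)
have QQ (v : 'cV_(h + r)) : Q *m (Q *m v) = 0 -> Q *m v = 0.
  rewrite mulmxA -pmxM -exprD => Qv.
  have [w ->] : exists w, v = X *m w.
    by apply: imX; apply: (@Ppart_exp P (mxmod A) v (N + N)).
  by rewrite mulmxA QX mul0mx.
have rkX : \rank X^T = h.
  apply/eqP/inj_row_free => v vX; apply: trmx_inj; rewrite trmx0.
  by apply: injX; rewrite -[X]trmxK -trmx_mul vX trmx0.
have rkQ : \rank Q = r.
  have kX : (kermx Q^T :=: X^T)%MS.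
    apply/eqmxP/andP; split; last first.
      by apply/sub_kermxP; rewrite -trmx_mul QX trmx0.
    apply/row_subP => i; set u := row i _.
    have uQ : u *m Q^T = 0 by apply/sub_kermxP; rewrite row_sub.
    have [|w uw] := kerQ u^T; first by rewrite -[Q]trmxK -trmx_mul uQ trmx0.
    by rewrite -[u]trmxK uw trmx_mul submxMl.
  have := mxrank_ker Q^T; rewrite kX rkX mxrank_tr.
  have := rank_leq_row Q; lia.
(* A rank factorisation of Q, first with inner size [\rank Q], then transported to [r] so that the
   blocks have the required sizes. *)
have [Y [Z [QYZ [Y' Y'Y] [Z' ZZ']]]] : exists (Y : 'M[F]_(h + r, r)) (Z : 'M[F]_(r, h + r)),
    [/\ Q = Y *m Z, exists Y', Y' *m Y = 1%:M & exists Z', Z *m Z' = 1%:M].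
  have : exists (Y : 'M[F]_(h + r, \rank Q)) (Z : 'M[F]_(\rank Q, h + r)),
      [/\ Q = Y *m Z, exists Y', Y' *m Y = 1%:M & exists Z', Z *m Z' = 1%:M].
    exists (col_base Q), (row_base Q); split; first by rewrite mulmx_base.
      exact/row_fullP/col_base_full.
    exact/row_freeP/row_base_free.
  by rewrite rkQ.
(* The matrix of [A] on im Q in the basis [Y]; since Q commutes with [A], A Y = A Q Z' = Q A Z' = Y
   B. *)
pose B := Z *m A *m Z'.
have YQ (b : 'cV_r) : Y *m b = Q *m (Z' *m b).
  by rewrite QYZ -!mulmxA [Z *m _]mulmxA ZZ' mul1mx.
have AY : A *m Y = Y *m B.
  have -> : Y = Q *m Z' by rewrite QYZ -mulmxA ZZ' mulmx1.
  rewrite mulmxA -(intertwine_pmx (P ^+ N) (erefl (A *m A))) -/Q /B.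
  by rewrite {1}QYZ -!mulmxA [Z' *m _]mulmxA QYZ -!mulmxA [Z *m (Z' *m _)]mulmxA ZZ' mul1mx.
have injY (b : 'cV_r) : Y *m b = 0 -> b = 0.
  by move=> /(congr1 (mulmx Y')); rewrite mulmxA Y'Y mul1mx mulmx0.
have unitI n (C : 'M[F]_n) : (forall v : 'cV_n, C *m v = 0 -> v = 0) -> C \in unitmx.
  move=> CI; rewrite -unitmx_tr -row_free_unit; apply: inj_row_free => v vC.
  apply: trmx_inj; rewrite trmx0; apply: CI.
  by rewrite -[C]trmxK -trmx_mul vC trmx0.
have gu : row_mx X Y \in unitmx.
  apply: unitI => v; rewrite -[v]vsubmxK; set a := usubmx v; set b := dsubmx v.
  rewrite mul_row_col => ab0.
  have b0 : b = 0.
    apply: injY; rewrite YQ; apply: QQ; rewrite -YQ.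
    move/(congr1 (mulmx Q)): ab0.
    by rewrite mulmxDr [X in X + _]mulmxA QX mul0mx add0r mulmx0.
  by move: ab0; rewrite b0 mulmx0 addr0 => /injX ->; rewrite col_mx0.
exists (row_mx X Y), B; split=> //; last first.
  rewrite -mulmxA mul_mx_row AX AY.
  have -> : row_mx (X *m M) (Y *m B) = row_mx X Y *m block_mx M 0 0 B.
    by rewrite mul_row_block !mulmx0 addr0 add0r.
  by rewrite mulKmx.
(* If P(B) w = 0, then Y w lies in the P-part and in im Q, hence is zero. *)
apply: unitI => w Bw; apply: injY; rewrite YQ; apply: QQ; rewrite -YQ.
have [|a ->] := imX (Y *m w); last by rewrite mulmxA QX mul0mx.
apply: (@Ppart_exp _ _ _ 1); rewrite expr1 mxmod_scaleE mulmxA.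
by rewrite (intertwine_pmx _ AY) -mulmxA Bw mulmx0.
Qed.

End Fitting.

(** * Cyclic vectors *)

Section Pmx.
Variable F : fieldType.

Lemma pmxD n (A : 'M[F]_n) p q : pmx A (p + q) = pmx A p + pmx A q.
Proof.
apply: eq_mulmx_col => v.
by rewrite mulmxDl -[LHS]/((p + q) *: (v : mxmod A)) scalerDl.
Qed.

Lemma pmxB n (A : 'M[F]_n) p q : pmx A (p - q) = pmx A p - pmx A q.
Proof. by apply/eqP; rewrite eq_sym subr_eq -pmxD subrK. Qed.

Lemma pmxXn n (A : 'M[F]_n) k : pmx A 'X^k = A ^+ k.
Proof.
elim: k => [|k ih]; first by rewrite !expr0 pmx1.
rewrite !exprS pmxM ih; congr (_ *m _); apply: eq_mulmx_col => v.
exact: (mxmod_scaleX (v : mxmod A)).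
Qed.

Lemma pmx_widen n (A : 'M[F]_n) (p : {poly F}) k : (size p <= k)%N ->
  pmx A p = \sum_(i < k) p`_i *: A ^+ i.
Proof.
move=> pk; rewrite /pmx -!(big_mkord xpredT (fun i => p`_i *: A ^+ i)).
rewrite [RHS](big_cat_nat (n := size p))//= [X in _ = _ + X]big_nat_cond.
rewrite [X in _ = _ + X]big1 ?addr0// => i /andP[/andP[pi _] _].
by rewrite nth_default// scale0r.
Qed.

(* The submodule generated by v in F^m, with t acting as A, is F[t]/(f) with *)
(* deg f = k. *)
Definition cyclic_dim m (A : 'M[F]_m) (v : 'cV[F]_m) (k : nat) : Prop :=
  (exists f, [/\ f \is monic, size f = k.+1 & pmx A f *m v = 0]) /\
  (forall p : {poly F}, (size p <= k)%N -> pmx A p *m v = 0 -> p = 0).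

Lemma cyclic_dim_uniq m (A : 'M[F]_m) v k k' :
  cyclic_dim A v k -> cyclic_dim A v k' -> k = k'.
Proof.
have lt a b : cyclic_dim A v a -> cyclic_dim A v b -> (b <= a)%N.
  move=> [[f [fm sf fv]] _] [_ bI]; rewrite leqNgt; apply/negP => ab.
  have f0 : f = 0 by apply: bI => //; rewrite sf.
  by move: sf; rewrite f0 size_poly0.
by move=> ak ak'; apply/eqP; rewrite eqn_leq !(lt _ _ ak, lt _ _ ak').
Qed.

Definition krylov m (A : 'M[F]_m) (v : 'cV[F]_m) k : 'M[F]_(m, k) :=
  \matrix_(i, j) (A ^+ j *m v) i 0.

Lemma col_krylov m (A : 'M[F]_m) v k (j : 'I_k) :
  col j (krylov A v k) = A ^+ j *m v.
Proof. by apply/colP => i; rewrite !mxE. Qed.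

Lemma krylov_mul m (A : 'M[F]_m) v k (c : 'rV[F]_k) :
  krylov A v k *m c^T = pmx A (rVpoly c) *m v.
Proof.
rewrite (@pmx_widen _ _ _ k) ?size_poly// mulmx_suml.
apply/colP => i; rewrite summxE mxE; apply: eq_bigr => j _.
by rewrite -scalemxAl coef_rVpoly_ord !mxE mulrC.
Qed.

Lemma krylov_rank m (A : 'M[F]_m) v k :
  (forall p : {poly F}, (size p <= k)%N -> pmx A p *m v = 0 -> p = 0) ->
  row_free (krylov A v k)^T.
Proof.
move=> kI; apply: inj_row_free => c /(congr1 trmx).
rewrite trmx_mul trmxK trmx0 krylov_mul => /kI -/(_ (size_poly _ _)) c0.
by rewrite -[c]rVpolyK c0 linear0.
Qed.

(** Among m + 1 Krylov vectors there is a linear relation; [k.+1] is the least size of a nonzero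
    polynomial annihilating [v], and independence of the first k Krylov vectors bounds k by m. *)
Lemma cyclic_dim_exists m (A : 'M[F]_m) v : exists k : 'I_m.+1, cyclic_dim A v k.
Proof.
have exn : exists n, `[< exists p : {poly F}, [/\ p != 0, size p = n & pmx A p *m v = 0] >].
  have : ~~ row_free (krylov A v m.+1)^T.
    rewrite /row_free mxrank_tr; have := rank_leq_row (krylov A v m.+1); lia.
  rewrite -kermx_eq0 => /rowV0Pn[c /sub_kermxP/(congr1 trmx)].
  rewrite trmx_mul trmxK trmx0 krylov_mul => c0 cn0.
  exists (size (rVpoly c)); apply/asboolP; exists (rVpoly c); split=> //.
  by apply: contraNneq cn0 => c00; rewrite -[c]rVpolyK c00 linear0.
case: (ex_minnP exn) => -[|k] /asboolP[p [p0 sp pv]] kmin.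
  by move: p0; rewrite -size_poly_eq0 sp.
have kI (g : {poly F}) : (size g <= k)%N -> pmx A g *m v = 0 -> g = 0.
  move=> gk gv; apply: contrapT => /eqP g0.
  have : (k < size g)%N by apply: kmin; apply/asboolP; exists g.
  by rewrite ltnNge gk.
have km : (k <= m)%N.
  have /eqP := krylov_rank kI; rewrite mxrank_tr => <-.
  exact: rank_leq_row.
exists (Ordinal (km : (k < m.+1)%N)); split=> //=.
have lp : lead_coef p != 0 by rewrite lead_coef_eq0.
exists ((lead_coef p)^-1%:P * p); split.
- by apply/monicP; rewrite lead_coefM lead_coefC mulVf.
- by rewrite mul_polyC size_scale ?invr_eq0.
- by rewrite pmxM -mulmxA pv mulmx0.
Qed.

(** The matrix of t on F[t]/(f) in the basis 1, t, ..., t^(k-1), where f = [cpoly c]. The last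
    column is [c] without a sign because f is t^k minus the polynomial of [c]; the class of 1 is
    [cvec0]. *)
Definition companion k (c : 'rV[F]_k) : 'M[F]_k :=
  \matrix_(i, j) ((i == j.+1 :> nat)%:R + (j.+1 == k)%:R * c 0 i).

Definition cvec0 k : 'cV[F]_k := \col_i (i == 0 :> nat)%:R.

Definition cpoly k (c : 'rV[F]_k) : {poly F} := 'X^k - rVpoly c.

Lemma size_cpoly k (c : 'rV[F]_k) : size (cpoly c) = k.+1.
Proof.
by rewrite size_polyDl ?size_polyXn// size_polyN ltnS size_poly.
Qed.

Lemma cpoly_monic k (c : 'rV[F]_k) : cpoly c \is monic.
Proof.
apply/monicP; rewrite lead_coefDl ?lead_coefXn// size_polyXn size_polyN.
by rewrite ltnS size_poly.
Qed.

Lemma monic_cpoly k (f : {poly F}) : f \is monic -> size f = k.+1 ->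
  exists c : 'rV_k, f = cpoly c.
Proof.
move=> fm sf; exists (poly_rV ('X^k - f)).
rewrite /cpoly poly_rV_K ?subKr//.
apply/leq_sizeP => j; rewrite leq_eqVlt coefB coefXn => /predU1P[<-|kj].
  by move/monicP: fm; rewrite /lead_coef sf eqxx/= => ->; rewrite subrr.
by rewrite gtn_eqF// nth_default ?subrr// sf.
Qed.

Lemma companion_exp k (c : 'rV[F]_k) j : (j < k)%N ->
  companion c ^+ j *m cvec0 k = \col_i (i == j :> nat)%:R.
Proof.
elim: j => [|j ih] jk; first by rewrite expr0 mul1mx.
rewrite exprS -mulmxE -mulmxA (ih (ltnW jk)); apply/colP => i; rewrite !mxE.
rewrite (bigD1 (Ordinal (ltnW jk)))//= !mxE eqxx mulr1 (ltn_eqF jk) mul0r addr0.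
rewrite big1 ?addr0// => l; rewrite -(inj_eq val_inj)/= => /negPf lj.
by rewrite !mxE lj mulr0.
Qed.

Lemma companion_top k (c : 'rV[F]_k) : companion c ^+ k *m cvec0 k = c^T.
Proof.
case: k c => [|k] c; first by rewrite !flatmx0.
rewrite exprS -mulmxE -mulmxA companion_exp//; apply/colP => i; rewrite !mxE.
rewrite (bigD1 ord_max)//= !mxE !eqxx mulr1 (ltn_eqF (ltn_ord i)) mul1r add0r.
rewrite big1 ?addr0// => l; rewrite -(inj_eq val_inj)/= => /negPf lk.
by rewrite !mxE lk mulr0.
Qed.

Lemma companion_pmx_small k (c : 'rV[F]_k) (p : {poly F}) : (size p <= k)%N ->
  pmx (companion c) p *m cvec0 k = (poly_rV p)^T.
Proof.
move=> pk; rewrite (pmx_widen _ pk) mulmx_suml; apply/colP => i.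
rewrite summxE !mxE (bigD1 i)//= -scalemxAl companion_exp// !mxE eqxx mulr1.
rewrite big1 ?addr0// => j ji; rewrite -scalemxAl companion_exp// !mxE.
by rewrite (inj_eq val_inj) eq_sym (negPf ji) mulr0.
Qed.

(** Only the remainder of [p] modulo [cpoly c] acts on [cvec0], and the result is its coefficient
    vector. *)
Lemma companion_pmx k (c : 'rV[F]_k) p :
  (pmx (companion c) p *m cvec0 k == 0) = (cpoly c %| p).
Proof.
have cp0 : pmx (companion c) (cpoly c) *m cvec0 k = 0.
  rewrite /cpoly pmxB mulmxBl pmxXn companion_top companion_pmx_small ?size_poly//.
  by rewrite rVpolyK subrr.
have c0 : cpoly c != 0 by rewrite monic_neq0 ?cpoly_monic.
rewrite [in LHS](divp_eq p (cpoly c)) pmxD pmxM mulmxDl -mulmxA cp0 mulmx0 add0r.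
have sm : (size (p %% cpoly c)%R <= k)%N by rewrite -ltnS -(size_cpoly c) ltn_modp.
rewrite companion_pmx_small// -trmx0 (inj_eq trmx_inj) /dvdp.
apply/eqP/eqP => [p0|->]; last by rewrite linear0.
by rewrite -(poly_rV_K sm) p0 linear0.
Qed.

(** Let f = [cpoly c] and C its companion matrix. If f = s P and P(C) is invertible, then s(C) kills
    the cyclic vector, so f divides s, contradicting degrees. If P does not divide f, a Bezout
    relation u P + w f = 1 evaluated at C, where f(C) = 0, inverts P(C). *)
Lemma companion_unit (P : {poly F}) k (c : 'rV[F]_k) : irreducible_poly P ->
  (pmx (companion c) P \in unitmx) = ~~ (P %| cpoly c).
Proof.
move=> irP; apply/idP/idP => [Pu|Pc].
  apply/negP => /dvdpP[s fE]; have f0 := monic_neq0 (cpoly_monic c).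
  have s0 : s != 0 by apply: contraNneq f0 => s0; rewrite fE s0 mul0r.
  have : pmx (companion c) (P * s) *m cvec0 k == 0.
    by rewrite companion_pmx fE mulrC.
  rewrite pmxM -mulmxA => /eqP/(congr1 (mulmx (invmx (pmx (companion c) P)))).
  rewrite mulKmx// mulmx0 => /eqP; rewrite companion_pmx => /(dvdp_leq s0).
  rewrite fE (size_mul s0 (irredp_neq0 irP)); have [] := irP.
  have := size_poly_gt0 s; rewrite s0; lia.
have : coprimep P (cpoly c).
  apply/coprimepP => d dP dc; have [//|dP'] := irredp_XsubCP irP dP.
  by case/negP: Pc; rewrite -(eqp_dvdl _ dP').
move=> /Bezout_eq1_coprimepP[[u w] /= uw].
have fz : pmx (companion c) (cpoly c) = 0.
  apply: eq_mulmx_col => v; rewrite mul0mx.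
  have -> : v = pmx (companion c) (rVpoly v^T) *m cvec0 k.
    by rewrite companion_pmx_small ?size_poly// rVpolyK trmxK.
  apply/eqP; rewrite mulmxA -pmxM companion_pmx; exact: dvdp_mulr.
have := congr1 (pmx (companion c)) uw.
by rewrite pmxD !pmxM fz mulmx0 addr0 pmx1 => /mulmx1_unit[].
Qed.

Lemma krylov_companion m (A : 'M[F]_m) v k (c : 'rV[F]_k) :
  pmx A (cpoly c) *m v = 0 -> A *m krylov A v k = krylov A v k *m companion c.
Proof.
move=> cv; have Ak : A ^+ k *m v = krylov A v k *m c^T.
  by apply/eqP; rewrite krylov_mul -subr_eq0 -mulmxBl -pmxXn -pmxB cv.
apply/matrixP => i j; transitivity ((A ^+ j.+1 *m v) i 0).
  rewrite exprS -mulmxE -mulmxA -col_krylov !mxE.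
  by apply: eq_bigr => l _; rewrite !mxE.
have [jk|kj] := ltnP j.+1 k.
  rewrite [RHS]mxE (bigD1 (Ordinal jk))//=.
  rewrite [krylov _ _ _ _ _]mxE [companion _ _ _]mxE/= eqxx (ltn_eqF jk).
  rewrite mul0r addr0 mulr1.
  rewrite big1 ?addr0// => l; rewrite -(inj_eq val_inj)/= => /negPf lj.
  by rewrite [companion _ _ _]mxE (ltn_eqF jk) lj mul0r addr0 mulr0.
have {}kj : j.+1 = k by apply/eqP; rewrite eqn_leq kj ltn_ord.
rewrite [in LHS]kj Ak !mxE; apply: eq_bigr => l _.
by rewrite !mxE kj eqxx mul1r (ltn_eqF (ltn_ord l)) add0r.
Qed.

End Pmx.

(** * Counting pairs (A, v) by the dimension of the submodule generated by v *)

Section KrylovCount.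
Variables (F : finFieldType) (P : {poly F}).
Hypothesis irP : irreducible_poly P.

Definition nondiv_set k : {set 'rV[F]_k} := [set c | ~~ (P %| cpoly c)].

Definition cyclic_pairs m k : {set 'M[F]_m * 'cV[F]_m} :=
  [set x | (pmx x.1 P \in unitmx) && `[< cyclic_dim x.1 x.2 k >]].

Section Block.
Variables k r : nat.

Let e : 'cV[F]_(k + r) := col_mx (cvec0 F k) 0.

Let T (y : 'rV[F]_k * 'M[F]_(k, r) * 'M[F]_r) : 'M[F]_(k + r) :=
  block_mx (companion y.1.1) y.1.2 0 y.2.

Let D : {set 'M[F]_(k + r)} :=
  [set T y | y in
    finset.setX (finset.setX (nondiv_set k) [set: 'M[F]_(k, r)]) (punitset P r)].

Let S (y : 'M[F]_(k, r) * 'M[F]_r) : 'M[F]_(k + r) := block_mx 1%:M y.1 0 y.2.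

Let K : {set 'M[F]_(k + r)} := [set S y | y in finset.setX [set: 'M[F]_(k, r)] (glset F r)].

Let T_pmx y p : pmx (T y) p *m e = col_mx (pmx (companion y.1.1) p *m cvec0 F k) 0.
Proof.
have TX : T y *m col_mx 1%:M 0 = col_mx 1%:M 0 *m companion y.1.1.
  by rewrite mul_block_col mul_col_mx !(mul0mx, mulmx0, mulmx1, mul1mx, addr0).
have -> : e = col_mx 1%:M 0 *m cvec0 F k by rewrite mul_col_mx mul0mx mul1mx.
by rewrite mulmxA (intertwine_pmx p TX) -mulmxA mul_col_mx mul0mx mul1mx.
Qed.

Let T_krylov y : krylov (T y) e k = col_mx 1%:M 0.
Proof.
apply/matrixP => i j; rewrite mxE -pmxXn T_pmx pmxXn companion_exp//.
case: (split_ordP i) => l ->; first by rewrite !col_mxEu !mxE.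
by rewrite !col_mxEd !mxE.
Qed.

Let S_unit y : (S y \in unitmx) = (y.2 \in unitmx).
Proof. by rewrite !unitmxE det_ublock unitrM det1 unitr1. Qed.

Lemma krylov_intertwine (A B g : 'M[F]_(k + r)) (v : 'cV_(k + r)) :
  A *m g = g *m B -> krylov A (g *m v) k = g *m krylov B v k.
Proof.
move=> AgB; apply/matrixP => i j.
rewrite mxE mulmxA (intertwine_exp j AgB) -mulmxA -col_krylov !mxE.
by apply: eq_bigr => l _; rewrite !mxE.
Qed.

(** The first k Krylov vectors of [e] under any [T y] are the first k basis vectors. Hence an [x]
    that fixes [e] and conjugates one normal form to another fixes these basis vectors, that is, has
    the shape [S]. *)
Let DK (g A x : 'M[F]_(k + r)) : g \in unitmx -> x \in unitmx -> A \in D ->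
  (invmx x *m A *m x \in D) && (g *m x *m e == g *m e) = (x \in K).
Proof.
move=> gu xu /imsetP[y yD ->].
have -> : (g *m x *m e == g *m e) = (x *m e == e).
  by rewrite -mulmxA (can_eq (mulKmx gu)).
apply/andP/imsetP => [[/imsetP[y' _ xT] /eqP xe]|[[s b]]].
  have {}xT : T y *m x = x *m T y' by rewrite -xT !mulmxA mulmxV// mul1mx.
  have := krylov_intertwine e xT; rewrite xe !T_krylov => x1.
  exists (ursubmx x, drsubmx x) => /=; last first.
    rewrite /S/= -[x in LHS]submxK.
    have [-> ->] : ulsubmx x = 1%:M /\ dlsubmx x = 0.
      move: x1; rewrite -[x in _ = x *m _ -> _]submxK mul_block_col.
      by rewrite !mulmx0 !mulmx1 !addr0 => /eq_col_mx[].
    by [].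
  rewrite !inE/= -(S_unit (ursubmx x, drsubmx x)) /S/=.
  move: x1; rewrite -[x in _ = x *m _ -> _]submxK mul_block_col.
  by rewrite !mulmx0 !mulmx1 !addr0 => /eq_col_mx[-> ->]; rewrite submxK.
rewrite !inE/= => bu xE.
have xe : x *m e = e.
  by rewrite xE mul_block_col !(mul0mx, mulmx0, mul1mx, addr0).
split; last by rewrite xe.
move: y yD => [[c d] B]; rewrite !inE/= andbT => /andP[cP BP].
have xV : invmx x = block_mx 1%:M (- s *m invmx b) 0 (invmx b).
  apply: (can_inj (mulKmx xu)); rewrite mulmxV// xE mulmx_block.
  rewrite !(mul0mx, mulmx0, mul1mx, mulmx1, addr0, add0r) mulNmx addNr mulmxV//.
  by rewrite -scalar_mx_block.
apply/imsetP; exists (c, - s *m invmx b *m B *m b + (companion c *m s + d *m b),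
  invmx b *m B *m b).
  by rewrite !inE/= cP pmx_conj_unit.
rewrite xV xE /T/= !mulmx_block/= !(mul0mx, mulmx0, mul1mx, mulmx1, addr0, add0r).
by congr block_mx; rewrite mulmxDl addrA [RHS]addrC.
Qed.

(** [orbit_count] with tag g -> g e: the pairs counted are the conjugates of the pairs (T y, e). The
    free off-diagonal blocks contribute the same factor q^(k r) to [K] and to [D], and it
    cancels. *)
Lemma card_cyclic_pairs_block :
  (#|cyclic_pairs (k + r) k| * #|glset F r| =
   #|glset F (k + r)| * (#|nondiv_set k| * #|punitset P r|))%N.
Proof.
have Sinj : injective S by move=> [s b] [s' b'] /eq_block_mx[_ /= -> _ ->].
have Tinj : injective T.
  move=> [[c d] b] [[c' d'] b'] /eq_block_mx[/= cc -> _ ->].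
  by rewrite -[c]trmxK -[c']trmxK -!companion_top cc.
have cK : #|K| = (#|F| ^ (k * r) * #|glset F r|)%N.
  by rewrite card_imset// cardsX cardsT card_mx.
have cD : #|D| = (#|nondiv_set k| * #|F| ^ (k * r) * #|punitset P r|)%N.
  by rewrite card_imset// !cardsX cardsT card_mx.
have F0 : (0 < #|F| ^ (k * r))%N by rewrite expn_gt0 (ltnW (card_finNzRing_gt1 F)).
apply/eqP; rewrite -(eqn_pmul2l F0); apply/eqP.
transitivity (#|cyclic_pairs (k + r) k| * #|K|)%N; first by rewrite cK mulnCA.
transitivity (#|glset F (k + r)| * #|D|)%N; last by rewrite cD; lia.
rewrite -(@orbit_count F (k + r) _ (fun g => g *m e) D K _ DK); last first.
  by apply/fintype.subsetP => _ /imsetP[y yK ->]; move: yK; rewrite !inE S_unit.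
congr (_ * _)%N; apply: eq_card => -[A v]; rewrite !inE/=.
apply/andP/existsP => [[Au /asboolP[[f [fm sf fv]] kI]]|[g /and3P[gu]]].
  have [c fc] := monic_cpoly fm sf; rewrite {}fc in fv.
  pose Z := krylov A v k.
  have AZ : A *m Z = Z *m companion c by exact: krylov_companion.
  have rZ : \rank Z = k by rewrite -mxrank_tr; apply/eqP/krylov_rank.
  have Zv : Z *m cvec0 F k = v.
    have -> : cvec0 F k = (poly_rV 1 : 'rV_k)^T.
      by apply/colP => i; rewrite !mxE coef1.
    (* For k = 0 the constant 1 does not fit in a row of length 0; then [v] is annihilated by the
       monic polynomial of degree 0, so [v] = 0. *)
    have [k0|k0] := posnP k; last first.
      by rewrite krylov_mul poly_rV_K ?size_poly1// pmx1 mul1mx.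
    have v0 : v = 0.
      have c0 : rVpoly c = 0.
        by apply/eqP; rewrite -size_poly_leq0 -[X in (_ <= X)%N]k0 size_poly.
      have X1 : 'X^k = 1 :> {poly F} by rewrite k0 expr0.
      by rewrite -fv /cpoly c0 X1 subr0 pmx1 mul1mx.
    by rewrite krylov_mul v0 mulmx0.
  (* The k independent columns of [Z] are completed to a basis by means of its Gaussian
     decomposition. *)
  have [g gu gZ] : exists2 g : 'M[F]_(k + r), g \in unitmx & g *m col_mx 1%:M 0 = Z.
    exists (col_ebase Z *m block_mx (row_ebase Z) 0 0 1%:M).
      rewrite unitmx_mul col_ebase_unit unitmxE det_ublock det1 mulr1.
      by rewrite -unitmxE row_ebase_unit.
    rewrite -mulmxA mul_block_col !(mul0mx, mulmx0, mulmx1, addr0).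
    rewrite -[RHS]mulmx_ebase rZ pid_mx_col -mulmxA mul_col_mx mul0mx mul1mx.
    by [].
  have BX : invmx g *m A *m g *m col_mx 1%:M 0 = col_mx (companion c) 0.
    rewrite -!mulmxA gZ AZ -gZ -!mulmxA mulKmx// mul_col_mx mul0mx mul1mx.
    by [].
  have BT : invmx g *m A *m g =
      T (c, ursubmx (invmx g *m A *m g), drsubmx (invmx g *m A *m g)).
    move: BX; set B := invmx g *m A *m g => BX; rewrite /T/= -[LHS]submxK.
    move: BX; rewrite -[X in X *m _]submxK mul_block_col.
    by rewrite !mulmx0 !mulmx1 !addr0 => /eq_col_mx[-> ->].
  have := Au; rewrite -(pmx_conj_unit _ _ gu) BT pmx_ublock_unit companion_unit//=.
  move=> /andP[cP BP].
  exists g; rewrite gu/=; apply/andP; split.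
    by apply/imsetP; eexists; last exact: BT; rewrite !inE/= cP BP.
  have -> : e = col_mx 1%:M 0 *m cvec0 F k by rewrite mul_col_mx mul0mx mul1mx.
  by rewrite mulmxA gZ Zv.
move=> /imsetP[y]; rewrite !inE andbT => /andP[cP BP] gT /eqP <-.
rewrite -(pmx_conj_unit _ _ gu) gT pmx_ublock_unit companion_unit// cP BP.
split=> //.
have Ag : A *m g = g *m T y by rewrite -gT !mulmxA mulmxV// mul1mx.
have Ap p : (pmx A p *m (g *m e) == 0) = (cpoly y.1.1 %| p).
  rewrite mulmxA (intertwine_pmx p Ag) -mulmxA T_pmx -companion_pmx.
  rewrite -[X in _ == X](mulmx0 _ g) (can_eq (mulKmx gu)).
  by rewrite -col_mx0; apply/eqP/eqP => [/eq_col_mx[]|->].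
split.
  exists (cpoly y.1.1); rewrite cpoly_monic size_cpoly; split=> //.
  by apply/eqP; rewrite Ap.
move=> p pk /eqP; rewrite Ap => cp; apply/eqP; apply: contraTT pk => p0.
by rewrite -ltnNge -(size_cpoly y.1.1) dvdp_leq.
Qed.

End Block.

End KrylovCount.

(** * The recursion for gamma and the number of matrices with given P-part *)

Section Recursion.
Variables (F : finFieldType) (P : {poly F}).
Hypotheses (monP : P \is monic) (irP : irreducible_poly P).

Let q := #|F|.
Let d := (size P).-1.

Let d_gt0 : (0 < d)%N.
Proof. by rewrite /d -ltnS prednK; case: irP => // /ltnW. Qed.

Let sizeP : size P = d.+1.
Proof. by rewrite /d prednK//; case: irP => /ltnW. Qed.

(** The monic multiples of P of degree k are the products of P with the monic polynomials of degree
    k - d. *)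
Lemma card_nondiv k :
  (#|nondiv_set P k| + (d <= k) * q ^ (k - d) = q ^ k)%N.
Proof.
have -> : (q ^ k = #|{: 'rV[F]_k}|)%N by rewrite card_mx mul1n.
rewrite -(cardsC (nondiv_set P k)); congr (_ + _)%N.
have [dk|kd] := leqP d k; last first.
  rewrite mul0n; apply/esym/eqP; rewrite cards_eq0 -finset.subset0.
  apply/fintype.subsetP => c; rewrite !inE negbK.
  move=> /dvdp_leq; rewrite monic_neq0 ?cpoly_monic// => /(_ isT).
  by rewrite sizeP size_cpoly ltnS leqNgt kd.
rewrite mul1n.
pose f (b : 'rV[F]_(k - d)) : 'rV[F]_k := poly_rV ('X^k - P * cpoly b).
have Pb (b : 'rV[F]_(k - d)) : cpoly (f b) = P * cpoly b.
  have [||c bc] := @monic_cpoly _ k (P * cpoly b).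
  - by rewrite monicMl ?cpoly_monic.
  - rewrite size_mul ?monic_neq0 ?cpoly_monic// sizeP size_cpoly addSn/=.
    by rewrite addnS subnKC.
  by rewrite /f bc /cpoly subKr rVpolyK.
have cpoly_inj n : injective (@cpoly F n).
  by move=> b b' /addrI/oppr_inj/(can_inj (@rVpolyK _ _)).
have f_inj : injective f.
  move=> b b' /(congr1 (@cpoly F k)); rewrite !Pb => /mulfI.
  by rewrite monic_neq0// => /(_ isT)/cpoly_inj.
have -> : (q ^ (k - d) = #|{: 'rV[F]_(k - d)}|)%N by rewrite card_mx mul1n.
rewrite -(card_imset _ f_inj); apply: eq_card => c; rewrite !inE negbK.
apply/imsetP/idP => [[b _ ->]|/dvdpP[s cs]]; first by rewrite Pb dvdp_mulr.
have sm : s \is monic by rewrite -(monicMr _ monP) -cs cpoly_monic.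
have [|b sb] := @monic_cpoly _ (k - d) s sm.
  have := size_cpoly c; rewrite cs size_mul ?monic_neq0// sizeP addnS/=.
  by move=> sd; apply/eqP; rewrite -(eqn_add2r d) sd addSn subnK.
by exists b => //; apply: cpoly_inj; rewrite Pb cs sb mulrC.
Qed.

Lemma card_glset n :
  #|glset F n| = (q ^ 'C(n, 2) * \prod_(1 <= i < n.+1) (q ^ i - 1))%N.
Proof.
case: n => [|n].
  rewrite big_geq//= muln1; apply/eqP/cards1P; exists 1%:M; apply/setP => A.
  by rewrite !inE [A]flatmx0 [1%:M]flatmx0 unitmxE det_mx00 unitr1 eqxx.
rewrite -card_GL// cardsT/= card_sub; apply: eq_card => A.
by rewrite !inE.
Qed.

Let q_gt1 : (1 < q)%N := card_finNzRing_gt1 F.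

Lemma card_glset_gt0 n : (0 < #|glset F n|)%N.
Proof. by apply/card_gt0P; exists 1%:M; rewrite inE unitmx1. Qed.

Lemma sum_cyclic_pairs m :
  (\sum_(k < m.+1) #|cyclic_pairs P m k| = #|punitset P m| * q ^ m)%N.
Proof.
have -> : (q ^ m = #|[set: 'cV[F]_m]|)%N by rewrite cardsT card_mx muln1.
rewrite -cardsX -sum1_card.
under [LHS]eq_bigr => k _ do rewrite -sum1_card big_mkcond/=.
rewrite exchange_big/= [RHS]big_mkcond/=; apply: eq_bigr => -[A v] _.
rewrite !inE/= andbT; case: ifPn => Au; last first.
  by rewrite big1// => k _; rewrite inE/= (negPf Au).
have [k0 Ak0] := cyclic_dim_exists A v.
rewrite (bigD1 k0)//= inE/= Au ifT; last exact/asboolP.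
rewrite big1// => k kk0; rewrite inE/= Au/= ifF//.
by apply/asboolP => /(cyclic_dim_uniq Ak0)/val_inj/esym/eqP; apply/negP.
Qed.

Section Field.
Variable K : numFieldType.

(* gamma_n *)
Definition punit_ratio n : K := #|punitset P n|%:R / #|glset F n|%:R.

Let qK : q%:R != 0 :> K.
Proof. by rewrite pnatr_eq0 -lt0n ltnW. Qed.

Let glK n : #|glset F n|%:R != 0 :> K.
Proof. by rewrite pnatr_eq0 -lt0n card_glset_gt0. Qed.

Lemma card_glset_field n : #|glset F n|%:R =
  q%:R ^+ (n * n) * \prod_(1 <= i < n.+1) (1 - q%:R ^- i) :> K.
Proof.
rewrite card_glset; elim: n => [|n ih].
  by rewrite !big_geq// mulr1 bin0n.
have -> : (q ^ 'C(n.+1, 2) * \prod_(1 <= i < n.+2) (q ^ i - 1) =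
    q ^ n * (q ^ n.+1 - 1) * (q ^ 'C(n, 2) * \prod_(1 <= i < n.+1) (q ^ i - 1)))%N.
  rewrite big_nat_recr//= binS bin1 expnD (mulnC (q ^ 'C(n, 2))%N) -!mulnA.
  by congr (_ * _)%N; rewrite [RHS]mulnC -mulnA.
rewrite natrM ih [X in X * _]natrM natrB ?expn_gt0 ?(ltnW q_gt1)// !natrX.
rewrite [in RHS]big_nat_recr//=.
have -> : (n.+1 * n.+1 = n * n + n + n.+1)%N by lia.
have qn := expf_neq0 n.+1 qK; rewrite !exprD.
move: (\prod_(1 <= i < n.+1) (1 - q%:R ^- i)) (q%:R ^+ (n * n)) => X Y.
by move: (q%:R ^+ n.+1) qn => Z Z0; field.
Qed.

(** [sum_cyclic_pairs] divided by |GL_m|, each term being given by [card_cyclic_pairs_block]. *)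
Lemma punit_ratio_sum m : q%:R ^+ m * punit_ratio m =
  \sum_(k < m.+1) #|nondiv_set P k|%:R * punit_ratio (m - k)%N.
Proof.
rewrite /punit_ratio mulrA mulrC -natrX -natrM mulnC -sum_cyclic_pairs.
rewrite natr_sum mulr_sumr; apply: eq_bigr => -[k km] _ /=.
apply: (mulfI (glK m)); rewrite mulVKf ?glK//.
apply: (mulIf (glK (m - k))); rewrite !mulrA mulfVK// -!natrM -mulnA.
have := card_cyclic_pairs_block irP k (m - k).
by rewrite subnKC// => ->.
Qed.

Lemma punit_ratio0 : punit_ratio 0 = 1.
Proof.
rewrite /punit_ratio; suff -> : punitset P 0 = glset F 0 by rewrite divff.
by apply/setP => A; rewrite !inE !unitmxE !det_mx00.
Qed.

(** Subtract q times the sum for m from the sum for m + 1: as phi_(k+1) - q phi_k = -[k + 1 = d],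
    the convolution collapses to its first term and one term of index d. *)
Lemma punit_ratio_rec m : (q%:R ^+ m.+1 - 1) * punit_ratio m.+1 =
  q%:R ^+ m.+1 * punit_ratio m - (d <= m.+1)%:R * punit_ratio (m.+1 - d)%N.
Proof.
have phi k : #|nondiv_set P k|%:R = q%:R ^+ k - (d <= k)%:R * q%:R ^+ (k - d) :> K.
  by apply/eqP; rewrite eq_sym subr_eq -!natrX -natrM -natrD card_nondiv.
have phi0 : #|nondiv_set P 0|%:R = 1 :> K.
  by rewrite phi leqNgt d_gt0 mul0r subr0.
have phiS k : #|nondiv_set P k.+1|%:R - q%:R * #|nondiv_set P k|%:R = - (k.+1 == d)%:R :> K.
  rewrite !phi exprS leq_eqVlt eq_sym ltnS mulrBr.
  case: eqP => [kd|_]/=.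
    rewrite kd subnn leqNgt -kd ltnS leqnn !(mul1r, mul0r, mulr0).
    by rewrite subr0 addrAC subrr add0r.
  have [dk|kd] := leqP d k; last by rewrite !(mul0r, mulr0, subr0) subrr oppr0.
  by rewrite !mul1r subSn// exprS subrr oppr0.
have step : q%:R ^+ m.+1 * punit_ratio m.+1 - q%:R * (q%:R ^+ m * punit_ratio m) =
    punit_ratio m.+1 - (d <= m.+1)%:R * punit_ratio (m.+1 - d)%N.
  rewrite !punit_ratio_sum big_ord_recl/= phi0 mul1r subn0 -addrA; congr (_ + _).
  rewrite mulr_sumr -sumrB -[RHS]mulNr.
  under eq_bigr => i _ do rewrite /bump/= add1n subSS mulrA -mulrBl phiS.
  have [dm|md] := leqP d m.+1; last first.
    rewrite oppr0 mul0r big1// => i _.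
    by rewrite ltn_eqF ?oppr0 ?mul0r// (leq_trans _ md)// ltnS.
  have dm' : (d.-1 < m.+1)%N by rewrite prednK.
  rewrite (bigD1 (Ordinal dm'))//= prednK// eqxx big1 ?addr0.
    by congr (_ * punit_ratio _); move: d_gt0; lia.
  move=> i; rewrite -(inj_eq val_inj)/= => id; case: eqP => [id'|]; last first.
    by rewrite oppr0 mul0r.
  by rewrite -id' eqxx in id.
rewrite mulrBl mul1r [X in _ = X * _ - _]exprS -mulrA.
move/eqP: step; rewrite subr_eq => /eqP ->; ring.
Qed.

(** By Fitting's decomposition the matrices in question form the orbit counted in [card_diag_orbit];
    the product is |GL_n| / q^(n^2). *)
Lemma card_Pmod_iso h r N (M : 'M[F]_h) : pmx M (P ^+ N) = 0 ->
  #|[set A : 'M[F]_(h + r) | `[< lmod_iso (Pmod P (mxmod A)) (mxmod M) >]]|%:R /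
    #|{: 'M[F]_(h + r)}|%:R =
  punit_ratio r / #|cent_set M|%:R * \prod_(1 <= i < (h + r).+1) (1 - q%:R ^- i) :> K.
Proof.
move=> PM; have -> : [set A : 'M[F]_(h + r) |
    `[< lmod_iso (Pmod P (mxmod A)) (mxmod M) >]] =
  [set A : 'M[F]_(h + r) |
    [exists g, (g \in unitmx) && (invmx g *m A *m g \in diag_set P r M)]].
  apply/setP => A; rewrite !inE; apply/asboolP/existsP.
    move=> /(Pmod_iso_block_diag PM)[g [B [gu BP gA]]]; exists g; rewrite gu gA.
    by apply/imsetP; exists B => //; rewrite inE.
  move=> [g /andP[gu /imsetP[B]]]; rewrite inE => BP gA.
  exact: (Pmod_block_diag PM gu BP).
have c0 : #|cent_set M|%:R != 0 :> K.
  rewrite pnatr_eq0 -lt0n; apply/card_gt0P; exists 1%:M.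
  by rewrite inE unitmx1 mulmx1 mul1mx eqxx.
have := congr1 (fun n => n%:R : K) (card_diag_orbit (P := P) r PM).
rewrite /= !natrM (card_glset_field (h + r)) card_mx natrX => cE.
have hr := expf_neq0 ((h + r) * (h + r)) qK.
apply: (mulIf hr); rewrite -[RHS]mulrA [_ * q%:R ^+ _ in RHS]mulrC -/q.
rewrite divfK//; apply: (mulIf (mulf_neq0 c0 (glK r))); rewrite cE /punit_ratio.
by field; rewrite c0 glK.
Qed.

End Field.
End Recursion.

(** * Torsion modules of finite length *)

Section FiniteLength.
Variables (F : fieldType) (P : {poly F}) (H : lmodType {poly F}).
Hypotheses (P0 : P != 0) (Hlen : finite_length H) (Htors : Ptorsion P H).

Let span (m : nat) (S : {pred H}) : Prop :=
  exists f : {linear 'rV[F]_m -> resF H}, forall x, x \in S -> exists v, x = f v.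

Let Ptors (x : H) : exists N, P ^+ N *: x = 0.
Proof.
have : x \in Ppart P (M := H) by rewrite Htors.
by move=> /asboolP[N PN]; exists N; apply: PN.
Qed.

(** Climb the composition series. Any [x] in [c i.+1] outside [c i] generates [c i.+1] over [c i] by
    simplicity, and as some Q = P^N kills [x], residues modulo Q suffice as multipliers of [x]. *)
Lemma torsion_finite_gen : exists m (f : {linear 'rV[F]_m -> resF H}),
  forall x, exists v, x = f v.
Proof.
have [n [c [csub c0 cn cS]]] := Hlen.
suff sp i : (i <= n)%N -> exists m, span m (c i).
  by have [m [f fS]] := sp n (leqnn n); exists m, f => x; apply: fS; rewrite cn.
elim: i => [|i ih] iN.
  exists 0%N, \0 => x; rewrite c0 inE => /eqP ->.
  by exists 0; rewrite linear0.
have [m [f fS]] := ih (ltnW iN); have [sub ne simple] := cS _ iN.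
have [x xS xN] : exists2 x, x \in c i.+1 & x \notin c i.
  apply: contrapT => nx; apply: ne => x; apply/idP/idP => [/sub//|xS].
  by apply: contrapT => /negP xN; apply: nx; exists x.
have [N PN] := Ptors x; set Q := P ^+ N in PN.
have Q0 : Q != 0 by rewrite expf_neq0.
pose S : {pred H} := fun y => `[< exists p : {poly F}, y - p *: x \in c i >].
have ci : GRing.submod_closed (c i) by apply: csub; apply: ltnW.
have [c00 cL] := ci.
have ci1 : GRing.submod_closed (c i.+1) by apply: csub.
have cD a b : a \in c i.+1 -> b \in c i.+1 -> a + b \in c i.+1.
  by move=> ai bi; rewrite -[a]scale1r; apply: ci1.2.
have SE : S =i c i.+1.
  have [] := simple S.
  - split; first by apply/asboolP; exists 0; rewrite scale0r subr0.
    move=> a u v /asboolP[p up] /asboolP[p' vp]; apply/asboolP; exists (a * p + p').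
    rewrite scalerDl -scalerA opprD addrACA -scalerBr; exact: cL.
  - by move=> y yi; apply/asboolP; exists 0; rewrite scale0r subr0.
  - move=> y /asboolP[p yp]; rewrite -[y](subrK (p *: x)).
    apply: cD; first exact: sub.
    by rewrite -[p *: x]addr0; apply: ci1.2 => //; apply: ci1.1.
  - move=> SE; case/negP: xN; rewrite -SE; apply/asboolP; exists 1.
    by rewrite scale1r subrr.
  - by [].
pose g (u : 'rV[F]_(m + size Q)) : resF H :=
  f (lsubmx u) + (rVpoly (rsubmx u) *: x : resF H).
have gl : linear g.
  move=> a u v; rewrite /g !linearP/= scalerDr addrACA; congr (_ + _).
  by rewrite scalerDl -mul_polyC -scalerA.
pose G : {linear 'rV[F]_(m + size Q) -> resF H} :=
  HB.pack g (GRing.isLinear.Build _ _ _ _ g gl).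
exists (m + size Q)%N, G => y; rewrite -SE => /asboolP[p /fS[v yv]].
exists (row_mx v (poly_rV (p %% Q))); rewrite /= /g row_mxKl row_mxKr -yv.
rewrite poly_rV_K; last by rewrite ltnW// ltn_modp.
have -> : p *: x = (p %% Q) *: x.
  by rewrite {1}(divp_eq p Q) scalerDl -scalerA PN scaler0 add0r.
by rewrite [RHS]subrK.
Qed.

Lemma torsion_finite_dim : lmod_iso (resF H) 'rV[F]_(dimF H).
Proof.
rewrite /dimF; apply: (xgetPex 0%N (P := [set h | lmod_iso (resF H) 'rV_h])).
have exm : exists m, `[< exists f : {linear 'rV[F]_m -> resF H},
    forall x, exists v, x = f v >].
  by have [m mf] := torsion_finite_gen; exists m; apply/asboolP.
case: (ex_minnP exm) => m /asboolP[f fS] mmin; exists m.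
apply: lmod_iso_sym; exists f.
have finj : injective f.
  apply: raddf_inj => u fu; apply: contrapT => /eqP /rV0Pn[j uj].
  case: m => [|m] in f fS mmin u fu j uj *; first by case: j uj.
  suff : (m.+1 <= m)%N by rewrite ltnn.
  apply: mmin; apply/asboolP.
  pose g (w : 'rV[F]_m) := f (w *m row' j 1%:M).
  have gl : linear g by move=> a w w'; rewrite /g mulmxDl -scalemxAl linearP.
  pose G : {linear 'rV[F]_m -> resF H} :=
    HB.pack g (GRing.isLinear.Build _ _ _ _ g gl).
  exists G => x /=.
  (* Subtracting this multiple of the kernel vector [u] clears coordinate [j] without changing the
     image. *)
  have [v ->] := fS x; pose v' := v - (v 0 j / u 0 j) *: u.
  exists (col' j v'); rewrite /g.
  have -> : col' j v' *m row' j 1%:M = v'.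
    apply/rowP => l; rewrite mxE; case: (unliftP j l) => [l' ->|->].
      rewrite (bigD1 l')//= !mxE eqxx mulr1 big1 ?addr0// => a al.
      by rewrite !mxE (inj_eq lift_inj) (negPf al) mulr0.
    rewrite big1 => [|a _]; last by rewrite !mxE eq_sym (negPf (neq_lift _ _)) mulr0.
    by rewrite !mxE divfK// subrr.
  by rewrite linearB linearZ/= fu scaler0 subr0.
have /choice[g gP] := fS.
by exists g => v; [apply: finj; rewrite -gP|rewrite -gP].
Qed.

Lemma torsion_mxmod : exists2 M : 'M[F]_(dimF H), lmod_iso H (mxmod M) &
  exists N, pmx M (P ^+ N) = 0.
Proof.
have := torsion_finite_dim; set h := dimF H => -[f [f' fK f'K]].
have f'L : linear f'.
  by move=> a x y; apply: (can_inj fK); rewrite linearP !f'K.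
pose phi (u : 'rV[F]_h) : 'rV[F]_h := f ('X *: (f' u : H)).
have phiL : linear phi.
  move=> a u v; rewrite /phi f'L scalerDr; set z := 'X *: (_ *: _).
  have -> : z = a *: ('X *: (f' u : H) : resF H).
    by rewrite /z -[LHS]/('X *: (a%:P *: (f' u : H))) scalerA mulrC -scalerA.
  exact: (linearP f).
pose Phi : {linear 'rV[F]_h -> 'rV[F]_h} :=
  HB.pack phi (GRing.isLinear.Build _ _ _ _ phi phiL).
(* Transposed because [dimF] uses row coordinates, while [mxmod] acts on columns. *)
pose M := (lin1_mx Phi)^T.
pose E (w : mxmod M) : H := f' (w : 'cV_h)^T.
have EX w : E ('X *: w) = 'X *: E w.
  rewrite mxmod_scaleX /E trmx_mul trmxK mul_rV_lin1/= /phi.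
  exact: fK.
have ED w w' : E (w + w') = E w + E w'.
  by rewrite /E linearD -[X in f' (X + _)]scale1r f'L scale1r.
have EC c w : E (c%:P *: w) = c%:P *: E w.
  rewrite mxmod_scaleC /E linearZ/= -[_ *: _ in LHS]addr0 f'L.
  have -> : f' 0 = 0 by apply: (can_inj fK); rewrite f'K linear0.
  by rewrite addr0.
have Ep p w : E (p *: w) = p *: E w.
  elim/poly_ind: p w => [|p c ih] w.
    by rewrite !scale0r -(scale0r w) -polyC0 EC polyC0 scale0r.
  by rewrite !scalerDl ED EC -!scalerA ih EX.
have EL : linear E by move=> a x y; rewrite ED Ep.
pose EE : {linear mxmod M -> H} := HB.pack E (GRing.isLinear.Build _ _ _ _ E EL).
have EI : bijective E.
  exists (fun x => (f x)^T) => [w|x]; first by rewrite /E f'K trmxK.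
  by rewrite /E trmxK fK.
exists M; first by apply: lmod_iso_sym; exists EE.
have /choice[N NP] : forall j : 'I_h, exists N, P ^+ N *: E (delta_mx j 0) = 0.
  by move=> j; apply: Ptors.
pose n := (\max_j N j)%N; exists n; apply/matrixP => i j.
have : pmx M (P ^+ n) *m (delta_mx j 0 : 'cV_h) = 0.
  suff PE : E (P ^+ n *: (delta_mx j 0 : mxmod M)) = E 0.
    exact: (bij_inj EI PE).
  rewrite Ep -(subnK (leq_bigmax (F := N) j : (N j <= n)%N)) exprD -scalerA NP scaler0.
  exact: esym (linear0 EE).
by rewrite -colE => /matrixP/(_ i 0); rewrite !mxE.
Qed.

End FiniteLength.

Lemma lmod_iso_dim_le (F : fieldType) (P : {poly F}) h n (M : 'M[F]_h) (A : 'M[F]_n) :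
  lmod_iso (Pmod P (mxmod A)) (mxmod M) -> (h <= n)%N.
Proof.
move=> /lmod_iso_sym[f /bij_inj finj].
have vfL : linear (fun v => val (f v)) by move=> a x y /=; rewrite !linearP.
have [X _ fX] := linear_mxmod (HB.pack (fun v => val (f v))
    (GRing.isLinear.Build _ (mxmod M) (mxmod A) _ _ vfL)
      : {linear mxmod M -> mxmod A}).
suff /eqP <- : row_free X^T by exact: rank_leq_col.
apply: inj_row_free => v vX; apply: trmx_inj; rewrite trmx0.
apply: finj; rewrite linear0; apply: val_inj.
by rewrite [LHS]fX -[X]trmxK -trmx_mul vX trmx0.
Qed.

(** Transport along the isomorphism sends an invertible matrix commuting with [M] to an automorphism
    of [H], and every automorphism arises so. Writing the set of automorphisms as the image of a
    finite set makes its [fset_set] computable. *)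
Lemma card_aut_mxmod (F : finFieldType) (H : lmodType {poly F}) h (M : 'M[F]_h) :
  lmod_iso H (mxmod M) -> card_aut H = #|cent_set M|.
Proof.
move=> [f [f' fK f'K]].
have f'L : linear f'.
  by move=> a x y; apply: (can_inj fK); rewrite linearP !f'K.
pose i (k : 'M[F]_h) : H -> H := fun x => f' (k *m (f x : 'cV_h)).
have i_inj : injective i.
  move=> k k' kk; apply: eq_mulmx_col => v.
  have /(congr1 f) := congr1 (fun j => j (f' v)) kk.
  by rewrite /i !f'K.
have -> : card_aut H = #|` fset_set (i @` [set` [fset k in enum (cent_set M)]%fset])|%fset.
  rewrite /card_aut; congr (#|` fset_set _|%fset); apply/seteqP; split => [g|g] /=.
    move=> [gL [g' gK g'K]].
    pose G : {linear H -> H} := HB.pack g (GRing.isLinear.Build _ _ _ _ g gL).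
    have GL : linear (fun v => f (G (f' v))) by move=> a x y; rewrite f'L !linearP.
    have [X XM GX] := linear_mxmod (HB.pack (fun v => f (G (f' v)))
      (GRing.isLinear.Build _ (mxmod M) (mxmod M) _ _ GL)
        : {linear mxmod M -> mxmod M}).
    exists X; last first.
      by apply/funext => x; rewrite /i -GX/= !fK.
    rewrite /= !inE mem_enum inE XM eqxx andbT.
    rewrite -unitmx_tr -row_free_unit; apply: inj_row_free => v vX.
    apply: trmx_inj; rewrite trmx0.
    have : f (G (f' v^T)) = 0.
      by rewrite [LHS]GX -[X]trmxK -trmx_mul vX trmx0.
    rewrite -[X in _ = X](linear0 f) => /(can_inj fK).
    rewrite -[X in _ = X](linear0 G) => /(can_inj gK) /(congr1 f).
    by rewrite f'K linear0.
  move=> [k]; rewrite /= !inE mem_enum inE => /andP[ku /eqP kM] <-; split.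
    move=> a x y; rewrite /i linearP/= mulmxDr -f'L; congr f'.
    congr (_ + _); rewrite !mxmod_scaleE !mulmxA.
    by rewrite (intertwine_pmx a kM).
  exists (fun x => f' (invmx k *m (f x : 'cV_h))) => x; rewrite /i f'K.
    by rewrite mulKmx// fK.
  by rewrite mulKVmx// fK.
rewrite fset_set_image// set_fsetK card_imfset//=.
rewrite cardE; apply: perm_size; apply: uniq_perm; rewrite ?enum_uniq ?fset_uniq//.
by move=> k; rewrite !inE.
Qed.

Local Open Scope classical_set_scope.

(** * The power series *)

Section FpsMul.
Variable K : numFieldType.
Implicit Types a b c : fps K.

Let tr n a : {poly K} := \poly_(i < n.+1) a i.

(** Coefficients up to m depend only on truncations at m, so the laws of [fps_mul] are inherited
    from polynomials. *)
Lemma fps_mul_coef m n a b : (n <= m)%N ->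
  fps_mul a b n = (tr m a * tr m b)`_n.
Proof.
move=> nm; rewrite coefM; apply: eq_bigr => k _; rewrite !coef_poly.
by rewrite !ifT//; have := ltn_ord k; lia.
Qed.

Lemma fps_mulC : commutative (@fps_mul K).
Proof. by move=> a b; apply/funext => n; rewrite !(@fps_mul_coef n)// mulrC. Qed.

Let fps_mul3 a b c n : fps_mul (fps_mul a b) c n = (tr n a * tr n b * tr n c)`_n.
Proof.
rewrite coefM; apply: eq_bigr => k _; rewrite coef_poly ifT; last first.
  by have := ltn_ord k; lia.
by rewrite (@fps_mul_coef n)// -ltnS.
Qed.

Lemma fps_mulA : associative (@fps_mul K).
Proof.
move=> a b c; apply/funext => n.
by rewrite fps_mulC !fps_mul3 mulrC mulrA.
Qed.

Lemma fps_mul1 : left_id (@fps_one K) (@fps_mul K).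
Proof.
move=> a; apply/funext => n; rewrite /fps_mul big_ord_recl/= subn0.
rewrite /fps_one /fps_poly coef1 mul1r big1 ?addr0// => i _.
by rewrite coef1 mul0r.
Qed.

HB.instance Definition _ :=
  Monoid.isComLaw.Build (fps K) (@fps_one K) (@fps_mul K) fps_mulA fps_mulC fps_mul1.

Lemma fps_divK a b : b 0%N != 0 -> fps_mul (fps_div a b) b = a.
Proof. by move=> b0; rewrite -fps_mulA fps_mulV// fps_mulC fps_mul1. Qed.

Lemma fps_div_uniq a b c : b 0%N != 0 -> fps_mul c b = a -> c = fps_div a b.
Proof.
move=> b0 <-; rewrite /fps_div -fps_mulA (fps_mulC b) fps_mulV//.
by rewrite fps_mulC fps_mul1.
Qed.

Definition fps_binom (c : K) e : fps K := fps_poly (1 - c *: 'X^e).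

Lemma fps_mul_binom a (c : K) e n :
  fps_mul a (fps_binom c e) n = a n - (e <= n)%:R * (c * a (n - e)%N).
Proof.
rewrite /fps_mul; under eq_bigr => k _ do
  rewrite /fps_binom /fps_poly coefB coef1 coefZ coefXn mulrBr.
rewrite sumrB; congr (_ - _).
  rewrite big_ord_recr/= subnn mulr1 big1 ?add0r// => k _.
  by rewrite subn_eq0 leqNgt ltn_ord mulr0.
have [en|ne] := leqP e n; last first.
  rewrite mul0r big1// => k _; rewrite (_ : (n - k == e)%N = false) ?mulr0//.
  by apply/eqP; lia.
have ne : (n - e < n.+1)%N by lia.
rewrite (bigD1 (Ordinal ne))//= subKn// eqxx mulr1 mul1r mulrC big1 ?addr0//.
move=> k; rewrite -(inj_eq val_inj)/= => kne.
rewrite (_ : (n - k == e)%N = false) ?mulr0//; apply/eqP.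
by have := ltn_ord k; move/eqP: kne; lia.
Qed.

Lemma fps_binom0 (c : K) e : (0 < e)%N -> fps_binom c e 0%N = 1.
Proof.
case: e => // e _.
by rewrite /fps_binom /fps_poly coefB coef1 coefZ coefXn/= mulr0 subr0.
Qed.

(** The substitution of t u for u. *)
Definition fps_dil (t : K) a : fps K := fun n => t ^+ n * a n.

Lemma fps_dilM (t : K) : {morph fps_dil t : a b / fps_mul a b}.
Proof.
move=> a b; apply/funext => n; rewrite /fps_dil /fps_mul mulr_sumr.
apply: eq_bigr => k _; rewrite mulrACA -exprD subnKC//.
by rewrite -ltnS.
Qed.

Lemma fps_dil1 (t : K) : fps_dil t (@fps_one K) = @fps_one K.
Proof.
apply/funext => -[|n]; rewrite /fps_dil /fps_one /fps_poly coef1 ?mulr1//.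
by rewrite mulr0.
Qed.

Lemma fps_dil_binom (t c : K) e : fps_dil t (fps_binom c e) = fps_binom (t ^+ e * c) e.
Proof.
apply/funext => n; rewrite /fps_dil /fps_binom /fps_poly !(coefB, coef1, coefZ, coefXn).
rewrite mulrBr; congr (_ - _); first by case: n => [|n]; rewrite ?mulr1 ?mulr0.
by case: eqP => [->|]; rewrite ?(mulr1, mulr0).
Qed.

End FpsMul.

(** * The partial products and the recursion of their limit *)

Section Bfactor.
Variables (K : numFieldType) (q d : nat).
Hypothesis q_gt1 : (1 < q)%N.

Let Q : K := q%:R.

Let Q0 : Q != 0.
Proof. by rewrite pnatr_eq0 -lt0n ltnW. Qed.

Lemma bfactorE i : bfactor K q d i =
  fps_div (fps_binom (Q ^- (i * d)) d) (fps_binom (Q ^ (1 - i%:Z)) 1).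
Proof.
by rewrite /bfactor /fps_binom expr1 exprZn exprVn exprM.
Qed.

Lemma bfactor_den i :
  fps_mul (bfactor K q d i) (fps_binom (Q ^ (1 - i%:Z)) 1) =
  fps_binom (Q ^- (i * d)) d.
Proof. by rewrite bfactorE fps_divK// fps_binom0 ?oner_neq0. Qed.

Lemma bfactor_dil i : fps_dil Q (bfactor K q d i.+1) = bfactor K q d i.
Proof.
rewrite [RHS]bfactorE; apply: fps_div_uniq; first by rewrite fps_binom0 ?oner_neq0.
have -> : fps_binom (Q ^ (1 - i%:Z)) 1 = fps_dil Q (fps_binom (Q ^ (1 - i.+1%:Z)) 1).
  rewrite fps_dil_binom expr1; congr fps_binom.
  by rewrite -[X in X * _]expr1z -expfzDr//; congr (_ ^ _); lia.
rewrite -fps_dilM bfactor_den fps_dil_binom; congr fps_binom.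
by rewrite mulSn exprD invfM mulrA mulfV ?mul1r// expf_neq0.
Qed.

Definition bpart N : fps K :=
  \big[@fps_mul K/@fps_one K]_(1 <= i < N.+1) bfactor K q d i.

(** Replacing u by q u turns factor i + 1 into factor i, so the product is only shifted; factor 0 is
    (1 - u^d) / (1 - q u). *)
Lemma bpart_dil N : fps_dil Q (bpart N.+1) = fps_mul (bfactor K q d 0) (bpart N).
Proof.
rewrite /bpart (big_morph _ (fps_dilM Q) (fps_dil1 Q)) big_add1/=.
under eq_bigr do rewrite bfactor_dil.
by rewrite big_ltn.
Qed.

Lemma bpartS N : bpart N.+1 = fps_mul (bpart N) (bfactor K q d N.+1).
Proof. by rewrite /bpart big_nat_recr. Qed.

(** The coefficient of u^(n+1) in (1 - q u) B_(N+1)(q u) = (1 - u^d) B_N(u), where B_N is the N-th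
    partial product. *)
Lemma bpart_rec_dil N n :
  Q ^+ n.+1 * bpart N.+1 n.+1 - Q * (Q ^+ n * bpart N.+1 n) =
  bpart N n.+1 - (d <= n.+1)%:R * bpart N (n.+1 - d)%N.
Proof.
have := congr1 (fun f => fps_mul f (fps_binom (Q ^ (1 - 0%:Z)) 1)) (bpart_dil N).
rewrite -[in RHS]fps_mulA (fps_mulC (bpart N)) fps_mulA bfactor_den mul0n expr0 invr1.
rewrite (fps_mulC (fps_binom 1 d)) => /(congr1 (fun f => f n.+1)).
by rewrite !fps_mul_binom /fps_dil !mul1r subr0 expr1z subn1.
Qed.

Lemma bpart_recE N : fps_mul (bpart N.+1) (fps_binom (Q ^- N) 1) =
  fps_mul (bpart N) (fps_binom (Q ^- (N.+1 * d)) d).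
Proof.
rewrite bpartS -fps_mulA -bfactor_den; congr (fps_mul _ (fps_mul _ (fps_binom _ _))).
by rewrite exprnN; congr (_ ^ _); lia.
Qed.

Lemma bpart_rec0 N : bpart N.+1 0 = bpart N 0 - (d == 0)%:R * bpart N 0.
Proof.
have := congr1 (fun f => f 0%N) (bpart_recE N).
rewrite !fps_mul_binom mul0r subr0 leqn0 => ->.
by case: d => [|d'] /=; rewrite ?muln0 ?expr0 ?invr1 ?mul1r ?mul0r.
Qed.

Lemma bpart_rec N n : bpart N.+1 n.+1 - Q ^- N * bpart N.+1 n =
  bpart N n.+1 - (d <= n.+1)%:R * (Q ^- (N.+1 * d) * bpart N (n.+1 - d)%N).
Proof.
have := congr1 (fun f => f n.+1) (bpart_recE N).
by rewrite !fps_mul_binom mul1r subn1.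
Qed.

(* [bpart N n.+1] is eliminated between [bpart_rec_dil] and [bpart_rec]. *)
Lemma bpart_step N n : (Q ^+ n.+1 - 1) * bpart N.+1 n.+1 =
  (Q ^+ n.+1 - Q ^- N) * bpart N.+1 n +
  (d <= n.+1)%:R * ((Q ^- (N.+1 * d) - 1) * bpart N (n.+1 - d)%N).
Proof.
have /eqP := bpart_rec_dil N n; rewrite subr_eq mulrA -exprS => /eqP E.
have /esym/eqP := bpart_rec N n; rewrite subr_eq => /eqP E'.
rewrite mulrBl mul1r E E'; ring.
Qed.

Hypothesis Q_cvg : Q ^- N @[N --> \oo] --> (0 : K).

Local Notation b := (bcoef K q d).

(** For d = 0 every numerator is 1 - 1; only the empty product survives, whence the shift to N +
    1. *)
Lemma bcoef_zero_exp n : d = 0%N -> b n = 0.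
Proof.
move=> d0; suff bN N m : bpart N.+1 m = 0.
  have : bpart N n @[N --> \oo] --> (0 : K).
    rewrite -cvg_shiftS/=; under eq_fun do rewrite bN; exact: cvg_cst.
  by apply: cvg_lim; exact: norm_hausdorff.
elim: m => [|m ih]; first by rewrite bpart_rec0 d0 mul1r subrr.
have /eqP := bpart_rec N m; rewrite ih mulr0 subr0 => /eqP ->.
by rewrite d0 muln0 expr0 invr1 leq0n !mul1r subn0 subrr.
Qed.

Section Positive.
Hypothesis d_gt0 : (0 < d)%N.

Lemma bpart0 N : bpart N 0 = 1.
Proof.
elim: N => [|N ih]; first by rewrite /bpart big_geq// /fps_one /fps_poly coef1.
by rewrite bpart_rec0 ih (gtn_eqF d_gt0) mul0r subr0.
Qed.

Let Qn_neq1 n : Q ^+ n.+1 - 1 != 0.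
Proof. by rewrite subr_eq0 -natrX -[1]/(1%:R) eqr_nat -(expn0 q) eqn_exp2l. Qed.

Let QNd : Q ^- (N.+1 * d) @[N --> \oo] --> (0 : K).
Proof.
have QS : Q ^- N.+1 @[N --> \oo] --> (0 : K).
  by have := Q_cvg; rewrite -cvg_shiftS.
case: d d_gt0 => // e _; elim: e => [|e ih].
  by under eq_fun do rewrite muln1.
under eq_fun do rewrite mulnS exprD invfM; rewrite -[0](mul0r (0 : K)).
exact: cvgM.
Qed.

(** Induction on n: in [bpart_step] the coefficient of index n + 1 has a factor that is nonzero and
    independent of N, and the right-hand side involves only smaller indices. Thus the [lim] in
    [bcoef] is a genuine limit. *)
Lemma cvg_bpart n : bpart N n @[N --> \oo] --> b n.
Proof.
suff: exists l : K, bpart N n @[N --> \oo] --> l.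
  by move=> [l bl]; rewrite /bcoef; exact: (cvgP (l : K) bl).
elim/ltn_ind: n => -[|n] ih.
  by exists 1; under eq_fun do rewrite bpart0; exact: cvg_cst.
have [l lb] := ih n (ltnSn n).
have [l' l'b] : exists l' : K, (d <= n.+1)%:R * bpart N (n.+1 - d)%N @[N --> \oo] --> l'.
  have [dn|nd] := leqP d n.+1; last first.
    by exists 0; under eq_fun do rewrite mul0r; exact: cvg_cst.
  have [|l' l'b] := ih (n.+1 - d)%N; first by lia.
  by exists l'; under eq_fun do rewrite mul1r.
exists ((Q ^+ n.+1 - 1)^-1 * ((Q ^+ n.+1 - 0) * l + (0 - 1) * l')).
rewrite -cvg_shiftS/=.
have -> : (fun N => bpart N.+1 n.+1) = fun N => (Q ^+ n.+1 - 1)^-1 *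
    ((Q ^+ n.+1 - Q ^- N) * bpart N.+1 n +
     (Q ^- (N.+1 * d) - 1) * ((d <= n.+1)%:R * bpart N (n.+1 - d)%N)).
  apply/funext => N; apply: (mulfI (Qn_neq1 n)).
  by rewrite bpart_step mulVKf//; ring.
apply: cvgM; first exact: cvg_cst.
apply: cvgD; apply: cvgM => //.
- by apply: cvgB => //; exact: cvg_cst.
- by rewrite (cvg_shiftS (fun N => bpart N n)).
- by apply: cvgB; [exact: QNd|exact: cvg_cst].
Qed.

Lemma bcoef0 : b 0 = 1.
Proof.
have : bpart N 0 @[N --> \oo] --> (1 : K).
  by under eq_fun do rewrite bpart0; exact: cvg_cst.
by apply: cvg_lim; exact: norm_hausdorff.
Qed.

Lemma bcoef_rec n : (Q ^+ n.+1 - 1) * b n.+1 =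
  Q ^+ n.+1 * b n - (d <= n.+1)%:R * b (n.+1 - d)%N.
Proof.
have bn := @cvg_bpart n; have bn1 := @cvg_bpart n.+1.
have bd := @cvg_bpart (n.+1 - d)%N.
rewrite -cvg_shiftS/= in bn1; rewrite -cvg_shiftS/= in bn.
have L : (Q ^+ n.+1 - 1) * bpart N.+1 n.+1 @[N --> \oo] --> (Q ^+ n.+1 - 1) * b n.+1.
  by apply: cvgM => //; exact: cvg_cst.
have R : (Q ^+ n.+1 - 1) * bpart N.+1 n.+1 @[N --> \oo] -->
    (Q ^+ n.+1 - 0) * b n + (d <= n.+1)%:R * ((0 - 1) * b (n.+1 - d)%N).
  under eq_fun do rewrite bpart_step.
  apply: cvgD; apply: cvgM => //; first by apply: cvgB => //; exact: cvg_cst.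
    exact: cvg_cst.
  by apply: cvgM => //; apply: cvgB; [exact: QNd|exact: cvg_cst].
have -> := cvg_unique (@norm_hausdorff _ K) L R.
ring.
Qed.

Lemma bcoef_unique (c : nat -> K) : c 0%N = 1 ->
  (forall n, (Q ^+ n.+1 - 1) * c n.+1 =
    Q ^+ n.+1 * c n - (d <= n.+1)%:R * c (n.+1 - d)%N) ->
  b =1 c.
Proof.
move=> c0 crec; elim/ltn_ind => -[|n] ih; first by rewrite bcoef0.
apply: (mulfI (Qn_neq1 n)); rewrite bcoef_rec crec ih//.
by have [dn|nd] := leqP d n.+1; rewrite ?mul0r// ih//; lia.
Qed.

End Positive.

End Bfactor.

(** * The limit of a sequence satisfying the recursion *)

Section LimitOfRecursion.
Variables (R : realType) (q d : nat) (b : nat -> R).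
Hypotheses (q_gt1 : (1 < q)%N) (d_gt0 : (0 < d)%N).
Hypothesis b0 : b 0%N = 1.
Hypothesis b_rec : forall n, (q%:R ^+ n.+1 - 1) * b n.+1 =
  q%:R ^+ n.+1 * b n - (d <= n.+1)%:R * b (n.+1 - d)%N.

Let Q : R := q%:R.
Let t : R := Q^-1.

Let Q_ge2 : 2 <= Q. Proof. by rewrite /Q ler_nat. Qed.
Let Q_neq0 : Q != 0. Proof. by rewrite pnatr_eq0 -lt0n ltnW. Qed.
Let t_gt0 : 0 < t. Proof. by rewrite invr_gt0; have := Q_ge2; lra. Qed.
Let t_le : t <= 2^-1.
Proof. by rewrite lef_pV2 ?posrE//; have := Q_ge2; lra. Qed.
Let tX n : t ^+ n = Q ^- n. Proof. by rewrite exprVn. Qed.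
Let tQ n : t ^+ n * Q ^+ n = 1. Proof. by rewrite tX mulVf// expf_neq0. Qed.
Let tn_le n : t ^+ n.+1 <= 2^-1.
Proof.
rewrite exprS; have : t ^+ n <= 1 by rewrite exprn_ile1//; have := t_le; have := t_gt0; lra.
have := exprn_gt0 n t_gt0; have := t_le; have := t_gt0; nra.
Qed.
Let tn_gt0 n : 0 < t ^+ n. Proof. exact: exprn_gt0. Qed.

(** With x = q^-(n+1), the recursion divided by q^(n+1) bounds the next term by (1 + x) / (1 - x)
    times the previous bound. As x <= 1/2, this factor is at most 1 + 4 x <= exp(4 x), and q >= 2
    gives 2 x <= q^-n, so the exponent stays below 4 (1 - x). *)
Lemma rec_bound n : `|b n| <= expR (4 * (1 - t ^+ n)).
Proof.
elim/ltn_ind: n => -[|n] ih.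
  by rewrite b0 normr1 expr0 subrr mulr0 expR0.
have Emono m : (m <= n)%N -> `|b m| <= expR (4 * (1 - t ^+ n)).
  move=> mn; apply: (le_trans (ih m _)); first by rewrite ltnS.
  rewrite ler_expR; have : t ^+ n <= t ^+ m; last by lra.
  by apply: ler_wiXn2l => //; have := t_le; have := t_gt0; lra.
set E := expR _ in Emono; set x := t ^+ n.+1.
have x0 : 0 < x by exact: tn_gt0.
have x1 : x <= 2^-1 by exact: tn_le.
have E0 : 0 < E by exact: expR_gt0.
have : (1 - x) * `|b n.+1| <= (1 + x) * E.
  have -> : (1 - x) * `|b n.+1| = `|b n - (d <= n.+1)%:R * (x * b (n.+1 - d)%N)|.
    rewrite -[1 - x]ger0_norm; last by lra.
    rewrite -normrM; congr `|_|; have /(congr1 (fun y => x * y)) := b_rec n.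
    rewrite !(mulrBr x) !mulrA mulrBr mulr1 -/Q tQ mul1r => ->; ring.
  apply: (le_trans (ler_normB _ _)); rewrite mulrDl mul1r; apply: lerD; first exact: Emono.
  have [dn|_] := leqP d n.+1; last by rewrite mul0r normr0 mulr_ge0// ltW.
  rewrite mul1r normrM gtr0_norm// ler_pM2l//; apply: Emono; lia.
move=> bE; have {bE} : `|b n.+1| <= (1 + 4 * x) * E.
  have := normr_ge0 (b n.+1); move: bE; move: `|b n.+1| => y yE y0.
  have h : 0 < 1 - x by lra.
  rewrite -(ler_pM2l h); apply: (le_trans yE); rewrite mulrA ler_pM2r//; nra.
move=> /le_trans; apply.
have tn : t ^+ n = Q * x by rewrite /x exprS mulrA mulfV// mul1r.
apply: (@le_trans _ _ (expR (4 * x) * E)).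
  by rewrite ler_pM2r// expR_ge1Dx.
rewrite -expRD ler_expR -/x tn; have := Q_ge2; nra.
Qed.

Let B := expR (4 : R).

Lemma rec_bounded n : `|b n| <= B.
Proof.
apply: (le_trans (rec_bound n)); rewrite ler_expR; have := tn_gt0 n; lra.
Qed.

Let B_gt0 : 0 < B. Proof. exact: expR_gt0. Qed.

Let psum j n : R := \sum_(k < n) b k * t ^+ (j * k).

Lemma sum_shift (f : nat -> R) e n :
  \sum_(k < n) (e <= k)%:R * f (k - e)%N = \sum_(k < n - e) f k.
Proof.
elim: n => [|n ih]; first by rewrite !big_ord0.
rewrite big_ord_recr/= ih; have [en|ne] := leqP e n.
  by rewrite subSn// big_ord_recr/= mul1r.
by rewrite mul0r addr0 (eqP (ltnW ne : (n - e == 0)%N)) (eqP (ne : (n.+1 - e == 0)%N)).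
Qed.

(** With v = q^-(j+1), an exact truncation of (1 - q v) B(q v) = (1 - v^d) B(v). For j = 0 the
    left-hand side is just b_n, which yields [cvg_rec]; for j > 0 the limit is [gf_rec]. *)
Lemma psum_rec j n : psum j n.+1 - t ^+ j * psum j n =
  psum j.+1 n.+1 - t ^+ (j.+1 * d) * psum j.+1 (n.+1 - d).
Proof.
have shift i e m : t ^+ (i * e) * psum i (m - e) =
    \sum_(k < m) (e <= k)%:R * (b (k - e)%N * t ^+ (i * k)).
  rewrite /psum mulr_sumr -(sum_shift (fun k => t ^+ (i * e) * (b k * t ^+ (i * k)))).
  apply: eq_bigr => k _; have [ek|_] := leqP e k; last by rewrite !mul0r.
  rewrite !mul1r mulrCA -exprD -mulnDr subnKC//.
have -> : t ^+ j * psum j n = t ^+ (j * 1) * psum j (n.+1 - 1) by rewrite muln1 subn1.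
rewrite !shift /psum -!sumrB; apply: eq_bigr => -[[|k] kn] _ /=.
  by rewrite !muln0 !expr0 leqn0 (gtn_eqF d_gt0) !mul0r.
rewrite mul1r subn1/=.
have E : t ^+ (j * k.+1) = t ^+ (j.+1 * k.+1) * Q ^+ k.+1.
  by rewrite mulSn exprD mulrAC tQ mul1r.
have := b_rec k; rewrite -/Q; move: (Q ^+ k.+1) E => z -> bk.
apply/eqP; rewrite -subr_eq0; apply/eqP.
transitivity (t ^+ (j.+1 * k.+1) *
  ((z - 1) * b k.+1 - (z * b k - (d <= k.+1)%:R * b (k.+1 - d)%N))).
  ring.
by rewrite bk subrr mulr0.
Qed.

(* gf j is B(q^-j) *)
Let gf j := limn (psum j).

Lemma cvg_psum j : psum j.+1 n @[n --> \oo] --> gf j.+1.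
Proof.
rewrite /gf; have -> : psum j.+1 = series (fun k => b k * t ^+ (j.+1 * k)).
  by apply/funext => n; rewrite /psum /series/= big_mkord.
apply: normed_cvg; apply: (@series_le_cvg _ _ (geometric B t)) => //.
- by move=> n; exact: normr_ge0.
- by move=> n; rewrite /= mulr_ge0 ?ltW.
- move=> n; rewrite /= normrM ler_pM// ?rec_bounded// ger0_norm; last by rewrite ltW.
  rewrite mulSn exprD; apply: ler_piMr; first exact: ltW.
  by apply: exprn_ile1; have := t_le; have := t_gt0; lra.
- by apply: is_cvg_geometric_series; rewrite gtr0_norm//; have := t_le; lra.
Qed.

Lemma cvg_psum_shift j e : psum j.+1 (n.+1 - e)%N @[n --> \oo] --> gf j.+1.
Proof.
rewrite -(cvg_shiftn e)/=.
under eq_fun do rewrite -addSn addnK.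
by have := @cvg_psum j; rewrite -cvg_shiftS.
Qed.

Lemma cvg_rec : b n @[n --> \oo] --> (1 - t ^+ d) * gf 1.
Proof.
have -> : b = fun n => psum 1 n.+1 - t ^+ d * psum 1 (n.+1 - d)%N.
  apply/funext => n; rewrite -{1}[d]mul1n -psum_rec expr0 mul1r /psum big_ord_recr/= mul0n.
  by rewrite expr0 mulr1 addrAC subrr add0r.
rewrite mulrBl mul1r; apply: cvgB; first by have := @cvg_psum_shift 0 0.
by apply: cvgM; [exact: cvg_cst|exact: cvg_psum_shift].
Qed.

Lemma gf_rec j : (1 - t ^+ j.+1) * gf j.+1 = (1 - t ^+ (j.+2 * d)) * gf j.+2.
Proof.
have L : psum j.+1 n.+1 - t ^+ j.+1 * psum j.+1 n @[n --> \oo] -->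
    (1 - t ^+ j.+1) * gf j.+1.
  rewrite mulrBl mul1r; apply: cvgB; first by have := @cvg_psum_shift j 0.
  by apply: cvgM; [exact: cvg_cst|exact: cvg_psum].
have L' : psum j.+1 n.+1 - t ^+ j.+1 * psum j.+1 n @[n --> \oo] -->
    (1 - t ^+ (j.+2 * d)) * gf j.+2.
  under eq_fun do rewrite psum_rec.
  rewrite mulrBl mul1r; apply: cvgB; first by have := @cvg_psum_shift j.+1 0.
  by apply: cvgM; [exact: cvg_cst|exact: cvg_psum_shift].
exact: (cvg_unique _ L L').
Qed.

(** The terms of positive index are dominated by a geometric series of ratio x <= 1/2, whose sum is
    at most 2. *)
Lemma gf_dist1 j : `|gf j.+1 - 1| <= 2 * B * t ^+ j.+1.
Proof.
set x := t ^+ j.+1; have x0 : 0 < x by exact: tn_gt0.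
have xc : (fun n => `|psum j.+1 n.+1 - 1|) @ \oo --> `|gf j.+1 - 1|.
  apply: cvg_norm; apply: cvgB; last exact: cvg_cst.
  by have := @cvg_psum_shift j 0.
rewrite -(cvg_lim _ xc)//; apply: limr_le; first exact: cvgP xc.
apply: nearW => n; rewrite /psum big_ord_recl/= muln0 expr0 mulr1 b0 [_ - 1]addrC addKr.
apply: (le_trans (ler_norm_sum _ _ _)).
apply: (@le_trans _ _ (B * x * \sum_(k < n) x ^+ k)).
  rewrite mulr_sumr; apply: ler_sum => k _.
  rewrite normrM /bump/= add1n -mulrA -exprS exprM -/x ler_pM// ?rec_bounded//.
  by rewrite ger0_norm// exprn_ge0// ltW.
have x1 : x <= 2^-1 by exact: tn_le.
have : \sum_(k < n) x ^+ k <= 2.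
  have := subrX1 x n; have : 0 < x ^+ n by exact: exprn_gt0.
  move: (\sum_(k < n) x ^+ k) (x ^+ n) => s y; nra.
move: (\sum_(k < n) x ^+ k) => s s2.
rewrite [leRHS](_ : _ = B * x * 2); last by ring.
by rewrite ler_pM2l// mulr_gt0.
Qed.

Let t_cvg : t ^+ n @[n --> \oo] --> (0 : R).
Proof. by apply: cvg_expr; rewrite gtr0_norm//; have := t_le; lra. Qed.

Lemma cvg_gf : gf j.+1 @[j --> \oo] --> (1 : R).
Proof.
have u : 2 * B * t ^+ j.+1 @[j --> \oo] --> 2 * B * (0 : R).
  apply: cvgM; first exact: cvg_cst.
  by have := t_cvg; rewrite -cvg_shiftS.
rewrite mulr0 in u; apply/subr_cvg0; apply/norm_cvg0P.
apply: (squeeze_cvgr _ _ u); last exact: cvg_cst.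
by apply: nearW => j; rewrite normr_ge0 gf_dist1.
Qed.

Let ratio i : R := (1 - Q ^- (i * d)) / (1 - Q ^- i).

Lemma prod_ratio N :
  \prod_(1 <= i < N.+2) ratio i * ((1 - t ^+ N.+1) * gf N.+1) = (1 - t ^+ d) * gf 1.
Proof.
have t1 n : 1 - t ^+ n.+1 != 0.
  by have := tn_le n; move: (t ^+ n.+1) => y y1; apply/lt0r_neq0; lra.
elim: N => [|N ih].
  by rewrite big_nat1 /ratio mul1n -!tX mulrA divfK.
rewrite big_nat_recr//= -ih -mulrA; congr (_ * _).
by rewrite (gf_rec N) /ratio -!tX mulrA divfK.
Qed.

Lemma cvg_prod_ratio :
  \prod_(1 <= i < N.+1) ratio i @[N --> \oo] --> (1 - t ^+ d) * gf 1.
Proof.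
rewrite -cvg_shiftS/=.
have den : (1 - t ^+ N.+1) * gf N.+1 @[N --> \oo] --> (1 : R).
  rewrite -[1 in X in _ --> X](mulr1 (1 : R)); apply: cvgM; last exact: cvg_gf.
  rewrite -[1 in X in _ --> X](subr0 (1 : R)); apply: cvgB; first exact: cvg_cst.
  by have := t_cvg; rewrite -cvg_shiftS.
have den0 : \forall N \near \oo, (1 - t ^+ N.+1) * gf N.+1 != 0.
  by apply: (cvgr_neq0 _ den); rewrite oner_neq0.
have : (1 - t ^+ d) * gf 1 * ((1 - t ^+ N.+1) * gf N.+1)^-1 @[N --> \oo] -->
    (1 - t ^+ d) * gf 1 * (1 : R)^-1.
  apply: cvgM; first exact: cvg_cst.
  by apply: cvgV => //; rewrite oner_neq0.
rewrite invr1 mulr1.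
apply: cvg_trans; apply: near_eq_cvg.
by near=> N; rewrite -(prod_ratio N) mulfK//; near: N.
Unshelve. all: by end_near.
Qed.

End LimitOfRecursion.

(** * Transfer from the reals to the complex numbers *)

Section RealCoefficients.
Variable R : realType.
Let C : numFieldType := R[i].

Lemma cvg_real_complex (u : nat -> R) (l : R) :
  u n @[n --> \oo] --> l -> ((u n)%:C%C : C) @[n --> \oo] --> (l%:C%C : C).
Proof.
(* In the order of [R[i]], a positive [e] has zero imaginary part, so it is a real epsilon. *)
move=> ul; apply/cvgrPdist_lt => e; rewrite ltcE => /andP[/= /eqP Ime Re0].
have eE : e = (complex.Re e)%:C%C by case: e Ime {Re0} => a b /= ->.
have /cvgrPdist_lt/(_ _ Re0) := ul; apply: filterS => n le.
rewrite eE; have -> : l%:C%C - (u n)%:C%C = (l - u n)%:C%C :> R[i].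
  by rewrite rmorphB.
by rewrite normc_def/= expr0n addr0 sqrtr_sqr ltcR.
Qed.

Variables (q d h : nat).
Hypothesis q_gt1 : (1 < q)%N.

Lemma cvg_inv_exp : (q%:R : R) ^- N @[N --> \oo] --> (0 : R).
Proof.
under eq_fun do rewrite -exprVn.
apply: cvg_expr; rewrite normfV normr_nat invf_lt1 ?ltr1n//.
by rewrite ltr0n ltnW.
Qed.

Lemma cvg_inv_exp_complex : (q%:R : C) ^- N @[N --> \oo] --> (0 : C).
Proof.
have := cvg_real_complex cvg_inv_exp; rewrite rmorph0.
by under eq_fun do rewrite fmorphV rmorphXn rmorph_nat.
Qed.

(** For d > 0 the embedded real sequence satisfies the recursion over [R[i]], so uniqueness
    applies. *)
Lemma bcoef_real n : bcoef C q d n = (bcoef R q d n)%:C%C.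
Proof.
have [d0|d_gt0] := posnP d.
  rewrite (bcoef_zero_exp _ q_gt1 _ d0).
  by rewrite (bcoef_zero_exp _ q_gt1 _ d0) rmorph0.
apply: (bcoef_unique q_gt1 cvg_inv_exp_complex d_gt0
  (c := fun m => (bcoef R q d m)%:C%C : C)).
  by rewrite (bcoef0 _ q_gt1)// rmorph1.
move=> m; have /(congr1 (real_complex R)) := bcoef_rec q_gt1 cvg_inv_exp d_gt0 m.
by rewrite rmorphB !rmorphM rmorphB rmorph1 !rmorphXn !rmorph_nat.
Qed.

Lemma bcoef_cvg : (0 < d)%N -> exists l : R,
  bcoef R q d n @[n --> \oo] --> l /\
  \prod_(1 <= i < N.+1) ((1 - q%:R ^- (i * d)) / (1 - q%:R ^- i)) @[N --> \oo] --> l.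
Proof.
move=> d_gt0; have b0 := bcoef0 R q_gt1 d_gt0.
have b_rec := bcoef_rec q_gt1 cvg_inv_exp d_gt0.
eexists; split; first exact: (cvg_rec q_gt1 d_gt0 b0 b_rec).
exact: (cvg_prod_ratio q_gt1 d_gt0 b0 b_rec).
Qed.

Lemma bcoef_complex_cvg : bcoef C q d n @[n --> \oo] -->
  (infprod (fun i => (1 - q%:R ^- (i * d)) / (1 - q%:R ^- i)) : C).
Proof.
have [d0|d_gt0] := posnP d.
  have -> : infprod (fun i => (1 - q%:R ^- (i * d)) / (1 - q%:R ^- i)) = 0 :> C.
    have : \prod_(1 <= i < N.+1) ((1 - q%:R ^- (i * d)) / (1 - q%:R ^- i)) @[N --> \oo]
        --> (0 : C).
      have c0 : (fun _ : nat => 0 : C) @ \oo --> (0 : C) by exact: cvg_cst.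
      rewrite -cvg_shiftS/=; apply: cvg_trans c0; apply: near_eq_cvg; apply: nearW => N.
      by rewrite big_ltn// d0 muln0 expr0 invr1 subrr !mul0r.
    by move=> p; exact: (cvg_lim (@norm_hausdorff _ C) p).
  under eq_fun do rewrite (bcoef_zero_exp _ q_gt1 _ d0); exact: cvg_cst.
have [l [bl pl]] := bcoef_cvg d_gt0.
have -> : infprod (fun i => (1 - q%:R ^- (i * d)) / (1 - q%:R ^- i)) = l%:C%C :> C.
  have : \prod_(1 <= i < N.+1) ((1 - q%:R ^- (i * d)) / (1 - q%:R ^- i)) @[N --> \oo]
      --> (l%:C%C : C).
    apply: cvg_trans (cvg_real_complex pl); apply: near_eq_cvg; apply: nearW => N.
    rewrite rmorph_prod; apply: eq_bigr => i _.
    by rewrite fmorph_div !rmorphB rmorph1 !fmorphV !rmorphXn !rmorph_nat.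
  by move=> p; exact: (cvg_lim (@norm_hausdorff _ C) p).
under eq_fun do rewrite bcoef_real.
exact: cvg_real_complex.
Qed.

(* The partial products of [1 - q^-i] decrease, hence converge, and their limit *)
(* cancels the denominators of the limit of [bcoef]. *)
Lemma cvg_bcoef_prod : (0 < d)%N ->
  bcoef R q d n * \prod_(1 <= i < (n + h).+1) (1 - q%:R ^- i) @[n --> \oo] -->
  infprod (fun i => 1 - q%:R ^- (i * d) : R).
Proof.
move=> d_gt0; have [l [bl pl]] := bcoef_cvg d_gt0.
have q0 : 0 < q%:R :> R by rewrite ltr0n ltnW.
have qi i : 0 < (q%:R : R) ^- i.+1 < 1.
  by rewrite invr_gt0 exprn_gt0//= invf_lt1 ?exprn_gt0// exprn_egt1// ltr1n.
pose E N : R := \prod_(1 <= i < N.+1) (1 - q%:R ^- i).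
have Epos N : 0 <= E N.
  rewrite /E big_add1/= prodr_ge0// => i _; have /andP[_ /ltW] := qi i.
  by rewrite subr_ge0.
have [e Ee] : exists e : R, E n @[n --> \oo] --> e.
  exists (limn E); apply: nonincreasing_is_cvgn; last first.
    by exists 0 => _ [N _ <-]; exact: Epos.
  apply/nonincreasing_seqP => N; rewrite /E [leLHS]big_nat_recr//=.
  apply: ler_piMr; first exact: Epos.
  by rewrite gerBl; have /andP[/ltW] := qi N.
have -> : infprod (fun i => 1 - q%:R ^- (i * d)) = l * e :> R.
  have : \prod_(1 <= i < N.+1) (1 - q%:R ^- (i * d)) @[N --> \oo] --> l * e.
    apply: cvg_trans (cvgM pl Ee : _ @ _ --> _); apply: near_eq_cvg; apply: nearW => N.
    rewrite /= /E -big_split/=; apply: eq_big_nat => -[|i] // _.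
    by rewrite divfK// subr_eq0 gt_eqF//; have /andP[] := qi i.
  by move=> p; exact: (cvg_lim (@norm_hausdorff _ R) p).
apply: cvgM => //.
by have := Ee; rewrite -(cvg_shiftn h).
Qed.

End RealCoefficients.

(** * Assembling the three claims *)

Lemma unif_prob_eq0 (R : realType) (T : finType) (E : T -> Prop) :
  (forall x, ~ E x) -> unif_prob R E = 0.
Proof.
move=> nE; rewrite /unif_prob; have -> : [set x | `[< E x >]]%SET = finset.set0.
  by apply/setP => x; rewrite !inE; apply/asboolP/nE.
by rewrite cards0 mul0r.
Qed.

Theorem theorem2p8 (R : realType) (F : finFieldType) (P : {poly F})
    (H : lmodType {poly F}) :
  P \is monic -> irreducible_poly P -> finite_length H -> Ptorsion P H ->
  let q := #|F| in
  let h := dimF H in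
  let degP := (size P).-1 in
  let C : numFieldType := R[i] in
  let b : nat -> nat -> C := fun d n => bcoef C q d n in
  let prob : nat -> R := fun n =>
    unif_prob R (fun A : 'M[F]_n => lmod_iso (Pmod P (mxmod A)) H) in
  [/\ forall n : nat,
        (prob n)%:C%C =
          if (h <= n)%N then
            b degP (n - h)%N / (card_aut H)%:R *
              \prod_(1 <= i < n.+1) (1 - q%:R ^- i)
          else 0 :> C,
      forall d : nat,
        b d n @[n --> \oo] -->
          (infprod (fun i => (1 - q%:R ^- (i * d)) / (1 - q%:R ^- i)) : C)
    & prob n @[n --> \oo] -->
        (card_aut H)%:R^-1 * infprod (fun i => 1 - q%:R ^- (i * degP) : R)].
Proof.
move=> monP irP Hlen Htors q h degP C b prob.
have q_gt1 : (1 < q)%N := card_finNzRing_gt1 F.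
have degP_gt0 : (0 < degP)%N by rewrite /degP -ltnS prednK; case: irP => // /ltnW.
have [M HM [N PM]] := torsion_mxmod (irredp_neq0 irP) Hlen Htors.
have MH := lmod_iso_sym HM.
(* b and gamma share the recursion and the value 1 at 0. *)
have bE : bcoef R q degP =1 punit_ratio P R.
  exact: (bcoef_unique q_gt1 (@cvg_inv_exp R q q_gt1) degP_gt0 (punit_ratio0 P R)
    (punit_ratio_rec monP irP R)).
have probE r : prob (h + r)%N = bcoef R q degP r / (card_aut H)%:R *
    \prod_(1 <= i < (h + r).+1) (1 - q%:R ^- i).
  rewrite bE (card_aut_mxmod HM) -(card_Pmod_iso monP irP R r PM).
  congr (#|pred_of_set _|%:R / _); apply/setP => A; rewrite !inE.
  by apply/asboolP/asboolP => [/lmod_iso_trans|/lmod_iso_trans]; apply.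
split.
- move=> n; case: ifPn => [hn|nh]; last first.
    rewrite /prob unif_prob_eq0 ?rmorph0// => A /lmod_iso_trans/(_ HM).
    by move/lmod_iso_dim_le; apply/negP.
  rewrite -{1}(subnKC hn) probE subnKC// /b bcoef_real//.
  rewrite rmorphM fmorph_div rmorph_nat rmorph_prod; congr (_ * _).
  by apply: eq_bigr => i _; rewrite rmorphB rmorph1 fmorphV rmorphXn rmorph_nat.
- by move=> d; exact: bcoef_complex_cvg.
(* From index h on, only the nonzero case of the formula occurs. *)
rewrite -(cvg_shiftn h)/=.
have cvg_const : (fun _ : nat => (card_aut H)%:R^-1 : R) @ \oo --> ((card_aut H)%:R^-1 : R).
  exact: cvg_cst.
apply: cvg_trans (cvgM cvg_const (@cvg_bcoef_prod R q degP h q_gt1 degP_gt0)).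
apply: near_eq_cvg; apply: nearW => n /=.
by rewrite [(n + h)%N]addnC probE mulrA [in RHS](mulrC (bcoef _ _ _ _)).
Qed.
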